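(* Let $\mathcal{C} \subseteq \omega^\omega$ be a compact set. The following are equivalent: (i) $\mathcal{C}$ is $\Pi^0_1$ encodable; (ii) $\mathcal{C}$ admits a $\Pi^0_1$ modulus; (iii) $\mathcal{C}$ has a non-empty $\Sigma^1_1$ subset.
   Context: $\omega^\omega$ is the Baire space with its usual topology. For a set $A\subseteq\omega$, $[A]^\omega$ denotes the collection of infinite subsets of $A$. $\Sigma^1_1$ is lightface (no parameters). For an oracle $Z$ (a subset of $\omega$ or a function in $\omega^\omega$), a set $\mathcal{D} \subseteq \omega^\omega$ is a $Z$-computably bounded $\Pi^{0,Z}_1$ set if $\mathcal{D} = [T]$, the set of infinite paths of $T$, for some $Z$-computable tree $T \subseteq \omega^{<\omega}$ whose nodes are bounded by a $Z$-computable function $b \in \omega^\omega$ (that is, $\sigma(x) \le b(x)$ for every $\sigma \in T$ and $x < |\sigma|$). A set $\mathcal{C} \subseteq \omega^\omega$ is $\Pi^0_1$ encodable if every $X \in [\omega]^\omega$ has an infinite subset $Y \in [X]^\omega$ such that $\mathcal{C}$ has a non-empty $Y$-computably bounded $\Pi^{0,Y}_1$ subset. A function $f \in \omega^\omega$ is a $\Pi^0_1$ modulus of $\mathcal{C} \subseteq \omega^\omega$ if for every function $g \in \omega^\omega$ with $g \geq f$ (pointwise), $\mathcal{C}$ has a non-empty $g$-computably bounded $\Pi^{0,g}_1$ subset. $\mathcal{C}$ admits a $\Pi^0_1$ modulus if such an $f$ exists. *)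

(* Defs.v *)
From Stdlib Require Cantor.
From mathcomp Require Import all_boot.
From mathcomp Require Import boolp classical_sets functions cardinality.
From mathcomp Require Import topology function_spaces.

Set Implicit Arguments.
Unset Strict Implicit.
Unset Printing Implicit Defensive.

Local Open Scope classical_set_scope.

(* The product of countably many copies of the discrete space [nat]. *)
Notation baire := {ptws nat -> nat}.

Definition pair_code (x y : nat) : nat := Cantor.to_nat (x, y).

(* Kleene's partial recursive functions with an oracle, presented as unary
   functions: tuples of arguments are packed with the Cantor pairing. *)
Inductive recfun : Type :=
| RZero | RSucc | RFst | RSnd | ROracle
| RPair of recfun & recfun
| RComp of recfun & recfun
| RPrec of recfun & recfun
| RMu of recfun.

(* [eval_in Z c n m]: the function of code [c] with oracle [Z] is defined at [n],
   with value [m]. In the case of [RPrec], [n] codes the pair of a parameter and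
   of the recursion argument, and [s] lists the successive values. *)
Fixpoint eval_in (Z : nat -> nat) (c : recfun) (n m : nat) : Prop :=
  match c with
  | RZero => m = 0
  | RSucc => m = n.+1
  | RFst => m = (Cantor.of_nat n).1
  | RSnd => m = (Cantor.of_nat n).2
  | ROracle => m = Z n
  | RPair c1 c2 =>
      exists m1 m2, [/\ eval_in Z c1 n m1, eval_in Z c2 n m2 & m = pair_code m1 m2]
  | RComp c1 c2 => exists k, eval_in Z c2 n k /\ eval_in Z c1 k m
  | RPrec c1 c2 =>
      let a := (Cantor.of_nat n).1 in
      let i := (Cantor.of_nat n).2 in
      exists s : nat -> nat,
        [/\ eval_in Z c1 a (s 0),
            forall j, j < i ->
              eval_in Z c2 (pair_code a (pair_code j (s j))) (s j.+1)
          & m = s i]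
  | RMu c1 =>
      eval_in Z c1 (pair_code n m) 0 /\
      forall j, j < m -> exists k, eval_in Z c1 (pair_code n j) k.+1
  end.

Definition computable_in (Z f : nat -> nat) : Prop :=
  exists c, forall n, eval_in Z c n (f n).

Definition char_fun (A : set nat) : nat -> nat := fun n => `[< A n >] : nat.

(* A bijection between finite strings and natural numbers. *)
Fixpoint string_code (s : seq nat) : nat :=
  if s is x :: s' then (pair_code x (string_code s')).+1 else 0.

Definition computable_strings_in (Z : nat -> nat) (T : set (seq nat)) : Prop :=
  exists2 f, computable_in Z f & forall s, f (string_code s) = (`[< T s >] : nat).

Definition is_tree (T : set (seq nat)) : Prop :=
  forall s t, prefix s t -> T t -> T s.

Definition paths (T : set (seq nat)) : set baire :=
  [set X | forall n, T (mkseq X n)].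

Definition cb_Pi01_in (Z : nat -> nat) (D : set baire) : Prop :=
  exists T : set (seq nat), exists b : nat -> nat,
    [/\ is_tree T,
        computable_strings_in Z T,
        computable_in Z b,
        forall s x, T s -> x < size s -> nth 0 s x <= b x
      & D = paths T].

Definition Pi01_encodable (C : set baire) : Prop :=
  forall X : set nat, infinite_set X ->
    exists Y : set nat,
      [/\ infinite_set Y, Y `<=` X
        & exists D, [/\ cb_Pi01_in (char_fun Y) D, D !=set0 & D `<=` C]].

Definition is_Pi01_modulus (C : set baire) (f : nat -> nat) : Prop :=
  forall g : nat -> nat, (forall n, f n <= g n) ->
    exists D, [/\ cb_Pi01_in g D, D !=set0 & D `<=` C].

Definition admits_Pi01_modulus (C : set baire) : Prop :=
  exists f, is_Pi01_modulus C f.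

Definition oplus (X Y : nat -> nat) : nat -> nat :=
  fun n => if odd n then Y n./2 else X n./2.

(* Lightface: the projection of a Pi^0_1 subset of the square of Baire space,
   given by a tree which is computable without oracle (equivalently, in the zero
   function). *)
Definition Sigma11 (S : set baire) : Prop :=
  exists T : set (seq nat),
    [/\ is_tree T,
        computable_strings_in (fun=> 0) T
      & S = [set X | exists Y : baire, paths T (oplus X Y)]].

(* Main.v *)
(* The delicate implication is from encodability to a Sigma-1-1 subset, proved by
   contraposition. Suppose that C has no non-empty Sigma-1-1 subset. Call an infinite
   set X lean ([no_sig_subset]) if C has no non-empty subset which is Sigma-1-1 in X.
   By a Gandy forcing argument, every non-empty class of sets which is Sigma-1-1 in a
   lean set has a lean member. Given a lean X and a pair of codes, X is thinned to a
   lean set all of whose infinite subsets Y give, through these codes, a tree [T^Y]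
   which is either empty or not included in C: one builds strings s_0, s_1, ... of
   increasing length and reservoirs X_0, X_1, ... such that no Y in X_n makes [T^Y]
   miss the cylinder of s_n. If the construction stops, then (by the open Ramsey
   theorem, and by compactness of C) a reservoir forces [T^Y] to contain a point
   outside C or no point at all. If it goes on, the limits of such constructions form
   a non-empty class which is Sigma-1-1 in X, so that one of them is outside C, which
   is closed. Diagonalising over all codes gives a set without good infinite subset.

   The open Ramsey theorem is needed with a Sigma-1-1 class of homogeneous sets. If
   every infinite subset of X contains a member of an open family O of finite sets, it
   suffices to ask that, as soon as a finite subset u of X' contains a member of O
   with the same maximum, u itself is in O: this is arithmetical in O. *)
Require Import Defs.
From mathcomp Require Import all_boot zify.
From mathcomp Require Import boolp classical_sets functions cardinality filter.
From mathcomp Require Import topology function_spaces.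
From Stdlib Require Cantor.

Set Implicit Arguments.
Unset Strict Implicit.
Unset Printing Implicit Defensive.

Local Open Scope classical_set_scope.

(** * Codes of pairs and strings *)

Definition pfst (n : nat) : nat := (Cantor.of_nat n).1.
Definition psnd (n : nat) : nat := (Cantor.of_nat n).2.

Lemma pfst_pair x y : pfst (pair_code x y) = x.
Proof. by rewrite /pfst /pair_code Cantor.cancel_of_to. Qed.

Lemma psnd_pair x y : psnd (pair_code x y) = y.
Proof. by rewrite /psnd /pair_code Cantor.cancel_of_to. Qed.

Lemma pair_pfst_psnd n : pair_code (pfst n) (psnd n) = n.
Proof. by rewrite /pfst /psnd /pair_code -surjective_pairing Cantor.cancel_to_of. Qed.

Lemma leq_add_pair x y : x + y <= pair_code x y.
Proof. by have := Cantor.to_nat_non_decreasing x y; rewrite /pair_code; lia. Qed.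

Lemma leq_pfst n : pfst n <= n.
Proof. by have := leq_add_pair (pfst n) (psnd n); rewrite pair_pfst_psnd; lia. Qed.

Lemma leq_psnd n : psnd n <= n.
Proof. by have := leq_add_pair (pfst n) (psnd n); rewrite pair_pfst_psnd; lia. Qed.

Lemma leq_pair x y x' y' : x <= x' -> y <= y' -> pair_code x y <= pair_code x' y'.
Proof.
move=> lex ley.
have := Cantor.to_nat_spec x y; have := Cantor.to_nat_spec x' y'.
rewrite -/(pair_code x y) -/(pair_code x' y'); nia.
Qed.

(** Fuel stands in for structural recursion on [psnd k']; the code itself is enough fuel because
    [psnd k' <= k']. *)
Fixpoint fuel_decode (fuel k : nat) : seq nat :=
  if fuel is f.+1 then
    if k is k'.+1 then pfst k' :: fuel_decode f (psnd k') else [::]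
  else [::].

Definition decode (k : nat) : seq nat := fuel_decode k k.

Lemma fuel_decodeK f k : k <= f -> string_code (fuel_decode f k) = k.
Proof.
elim: f k => [|f IHf] [|k] //= lekf.
by rewrite IHf ?pair_pfst_psnd //; exact: leq_trans (leq_psnd k) lekf.
Qed.

Lemma decodeK k : string_code (decode k) = k.
Proof. exact: fuel_decodeK. Qed.

Lemma string_code_inj : injective string_code.
Proof.
elim=> [|x s IHs] [|y t] //= [] /(congr1 Cantor.of_nat).
by rewrite !Cantor.cancel_of_to => -[-> /IHs ->].
Qed.

Lemma string_codeK s : decode (string_code s) = s.
Proof. by apply: string_code_inj; rewrite decodeK. Qed.

Lemma leq_string_code s t : size s = size t ->
  (forall j, j < size s -> nth 0 s j <= nth 0 t j) -> string_code s <= string_code t.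
Proof.
elim: s t => [|x s IHs] [|y t] //= [] eqst le_st.
rewrite ltnS; apply: leq_pair; first exact: (le_st 0).
by apply: IHs => // j ltj; exact: (le_st j.+1).
Qed.

(** On codes, taking the tail is [psnd k.-1], so access to an entry is an iteration, hence primitive
    recursive. Past the end the code stays at 0, which yields the default value 0. *)
Lemma nth_string_code s j :
  nth 0 s j = pfst (iter j (fun k => psnd k.-1) (string_code s)).-1.
Proof.
elim: s j => [|x s IHs] j.
  rewrite nth_nil (_ : iter _ _ _ = 0) //.
  by elim: j => //= j ->.
case: j => [|j] /=; first by rewrite pfst_pair.
by rewrite IHs -[psnd _]/((fun k => psnd k.-1) _) -iterS iterSr /= psnd_pair.
Qed.

(** * Closure properties of relative computability *)

Section Computable.
Variable Z : nat -> nat.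
Local Notation comp := (computable_in Z).

Lemma computable_zero : comp (fun=> 0).
Proof. by exists RZero. Qed.

Lemma computable_oracle : comp Z.
Proof. by exists ROracle. Qed.

Lemma computable_pair f g : comp f -> comp g -> comp (fun n => pair_code (f n) (g n)).
Proof. by move=> [c cf] [d dg]; exists (RPair c d) => n; exists (f n), (g n). Qed.

Lemma computable_comp f g : comp f -> comp g -> comp (fun n => f (g n)).
Proof. by move=> [c cf] [d dg]; exists (RComp c d) => n; exists (g n). Qed.

Lemma computable_S f : comp f -> comp (fun n => (f n).+1).
Proof. by apply: computable_comp; exists RSucc. Qed.

Lemma computable_pfst f : comp f -> comp (fun n => pfst (f n)).
Proof. by apply: computable_comp; exists RFst. Qed.

Lemma computable_psnd f : comp f -> comp (fun n => psnd (f n)).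
Proof. by apply: computable_comp; exists RSnd. Qed.

Lemma computable_id : comp id.
Proof.
rewrite (_ : id = fun n => pair_code (pfst n) (psnd n)).
  by apply: computable_pair; [exists RFst | exists RSnd].
by apply/funext => n; rewrite pair_pfst_psnd.
Qed.

Lemma computable_const k : comp (fun=> k).
Proof. by elim: k => [|k]; [exact: computable_zero | exact: computable_S]. Qed.

(** Most later closure properties reduce to this scheme. [RPrec] reads its parameter and its number
    of steps from one pair, which is why [n] gets paired with [I n]. *)
Lemma computable_rec (A : nat -> nat) (H : nat -> nat -> nat -> nat) (I : nat -> nat) :
  comp A -> comp (fun p => H (pfst p) (pfst (psnd p)) (psnd (psnd p))) -> comp I ->
  comp (fun n => nat_rect (fun=> nat) (A n) (H n) (I n)).
Proof.
move=> [a eA] [h eH] cI.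
pose F p := nat_rect (fun=> nat) (A (pfst p)) (H (pfst p)) (psnd p).
rewrite (_ : (fun n => _) = fun n => F (pair_code n (I n))); last first.
  by apply/funext => n; rewrite /F pfst_pair psnd_pair.
apply: computable_comp; last exact: computable_pair computable_id cI.
exists (RPrec a h) => p; exists (nat_rect (fun=> nat) (A (pfst p)) (H (pfst p))).
split=> // j _ /=.
by have := eH (pair_code (pfst p) (pair_code j
  (nat_rect (fun=> nat) (A (pfst p)) (H (pfst p)) j))); rewrite !(pfst_pair, psnd_pair).
Qed.

Lemma computable_mu (b : nat -> nat -> bool) (g : nat -> nat) :
  comp (fun p => b (pfst p) (psnd p)) ->
  (forall n, b n (g n) /\ forall j, j < g n -> ~~ b n j) -> comp g.
Proof.
move=> cb gP.
(* [RMu] searches for a zero, so truth is coded by 0 here. *)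
have [c ec] : comp (fun p => nat_rect (fun=> nat) 1 (fun _ _ => 0) (b (pfst p) (psnd p))).
  by apply: computable_rec; [exact: computable_const | exact: computable_const |].
exists (RMu c) => n; have [bg nb] := gP n; split.
  by have := ec (pair_code n (g n)); rewrite pfst_pair psnd_pair bg.
move=> j /nb nbj; exists 0.
by have := ec (pair_code n j); rewrite pfst_pair psnd_pair (negbTE nbj).
Qed.

Lemma computable_if (b : nat -> bool) f g : comp b -> comp f -> comp g ->
  comp (fun n => if b n then f n else g n).
Proof.
move=> cb cf cg.
rewrite (_ : (fun n => _) = fun n => nat_rect (fun=> nat) (g n) (fun _ _ => f n) (b n)).
  by apply: computable_rec => //; apply: computable_comp cf _; exact: computable_pfst computable_id.
by apply/funext => n; case: (b n).
Qed.

Lemma computable_pred f : comp f -> comp (fun n => (f n).-1).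
Proof.
apply: (computable_comp (f := predn)).
rewrite (_ : predn = fun n => nat_rect (fun=> nat) 0 (fun j _ => j) n).
  apply: computable_rec; [exact: computable_zero | | exact: computable_id].
  by do 2!apply: computable_pfst || apply: computable_psnd; exact: computable_id.
by apply/funext => -[].
Qed.

Lemma computable_add f g : comp f -> comp g -> comp (fun n => f n + g n).
Proof.
move=> cf cg.
rewrite (_ : (fun n => _) = fun n => nat_rect (fun=> nat) (f n) (fun _ v => v.+1) (g n)).
  apply: computable_rec => //; apply: computable_S.
  by do 2!apply: computable_psnd; exact: computable_id.
by apply/funext => n; elim: (g n) => [|k IHk]; rewrite ?addn0 //= -IHk addnS.
Qed.

Lemma computable_sub f g : comp f -> comp g -> comp (fun n => f n - g n).
Proof.
move=> cf cg.
rewrite (_ : (fun n => _) = fun n => nat_rect (fun=> nat) (f n) (fun _ v => v.-1) (g n)).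
  apply: computable_rec => //; apply: computable_pred.
  by do 2!apply: computable_psnd; exact: computable_id.
by apply/funext => n; elim: (g n) => [|k IHk]; rewrite ?subn0 //= -IHk subnS.
Qed.

Lemma computable_eq0 f : comp f -> comp (fun n => f n == 0).
Proof.
move=> cf; rewrite (_ : (fun n => _) = fun n => 1 - f n).
  by apply: computable_sub => //; exact: computable_const.
by apply/funext => n; case: (f n).
Qed.

Lemma computable_leq f g : comp f -> comp g -> comp (fun n => f n <= g n).
Proof. by move=> cf cg; apply: computable_eq0; exact: computable_sub. Qed.

Lemma computable_neg (b : nat -> bool) : comp b -> comp (fun n => ~~ b n).
Proof.
move=> cb; rewrite (_ : (fun n => _) = fun n => (b n == 0 :> nat) : nat).
  exact: computable_eq0.
by apply/funext => n; case: (b n).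
Qed.

Lemma computable_and (b c : nat -> bool) : comp b -> comp c -> comp (fun n => b n && c n).
Proof.
move=> cb cc; rewrite (_ : (fun n => _) = fun n => if b n then c n : nat else 0).
  by apply: computable_if => //; exact: computable_zero.
by apply/funext => n; case: (b n).
Qed.

Lemma computable_eq f g : comp f -> comp g -> comp (fun n => f n == g n).
Proof.
move=> cf cg; rewrite (_ : (fun n => _) = fun n => (f n <= g n) && (g n <= f n) : nat).
  by apply: computable_and; exact: computable_leq.
by apply/funext => n; rewrite eqn_leq.
Qed.

Lemma computable_odd f : comp f -> comp (fun n => odd (f n)).
Proof.
move=> cf; rewrite (_ : (fun n => _) = fun n => nat_rect (fun=> nat) 0 (fun _ v => v == 0) (f n)).
  apply: computable_rec => //; first exact: computable_zero.
  by apply: computable_eq0; do 2!apply: computable_psnd; exact: computable_id.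
by apply/funext => n; elim: (f n) => //= k <-; case: (odd k).
Qed.

Lemma computable_half f : comp f -> comp (fun n => (f n)./2).
Proof.
move=> cf; rewrite (_ : (fun n => _) =
    fun n => nat_rect (fun=> nat) 0 (fun j v => v + odd j) (f n)).
  apply: computable_rec => //; first exact: computable_zero.
  apply: computable_add; first by do 2!apply: computable_psnd; exact: computable_id.
  by apply: computable_odd; apply: computable_pfst; apply: computable_psnd; exact: computable_id.
by apply/funext => n; elim: (f n) => //= k <-; rewrite uphalf_half addnC.
Qed.

Lemma computable_nth f g : comp f -> comp g -> comp (fun n => nth 0 (decode (f n)) (g n)).
Proof.
move=> cf cg; rewrite (_ : (fun n => _) =
    fun n => pfst (nat_rect (fun=> nat) (f n) (fun _ v => psnd v.-1) (g n)).-1).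
  apply: computable_pfst; apply: computable_pred; apply: computable_rec => //.
  by apply: computable_psnd; apply: computable_pred; do 2!apply: computable_psnd;
    exact: computable_id.
by apply/funext => n; rewrite nth_string_code decodeK; congr (pfst _.-1); elim: (g n) => //= k ->.
Qed.

Lemma computable_all (b : nat -> nat -> bool) I :
  comp (fun p => b (pfst p) (psnd p)) -> comp I ->
  comp (fun n => all (b n) (iota 0 (I n))).
Proof.
move=> cb cI; rewrite (_ : (fun n => _) =
    fun n => nat_rect (fun=> nat) 1 (fun j v => (0 < v) && b n j) (I n)).
  apply: computable_rec => //; first exact: computable_const.
  apply: computable_and.
    by apply: computable_leq; [exact: computable_const | do 2!apply: computable_psnd;
      exact: computable_id].
  rewrite (_ : (fun n => _) = fun p => b (pfst (pair_code (pfst p) (pfst (psnd p))))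
     (psnd (pair_code (pfst p) (pfst (psnd p)))) : nat); last first.
    by apply/funext => p; rewrite pfst_pair psnd_pair.
  apply: (computable_comp cb).
  apply: computable_pair; first by apply: computable_pfst; exact: computable_id.
  by apply: computable_pfst; apply: computable_psnd; exact: computable_id.
apply/funext => n; elim: (I n) => // k IHk.
by rewrite -[in LHS]addn1 iotaD all_cat /= -IHk andbT add0n lt0b.
Qed.

Lemma computable_has (b : nat -> nat -> bool) I :
  comp (fun p => b (pfst p) (psnd p)) -> comp I ->
  comp (fun n => has (b n) (iota 0 (I n))).
Proof.
move=> cb cI; rewrite (_ : (fun n => _) =
    fun n => ~~ all (fun j => ~~ b n j) (iota 0 (I n)) : nat).
  by apply: computable_neg; apply: computable_all => //; exact: computable_neg.
by apply/funext => n; rewrite -has_predC; congr nat_of_bool; apply: eq_has => j /=; rewrite negbK.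
Qed.

(** The size is found by minimisation, as the least number of tails that leads to the code 0. *)
Lemma computable_size f : comp f -> comp (fun n => size (decode (f n))).
Proof.
move=> cf.
apply: (computable_mu (b := fun n i => iter i (fun k => psnd k.-1) (f n) == 0)).
  rewrite (_ : (fun p => _) = fun p =>
    (nat_rect (fun=> nat) (f (pfst p)) (fun _ v => psnd v.-1) (psnd p) == 0) : nat).
    apply: computable_eq0; apply: computable_rec.
    - by apply: computable_comp cf _; apply: computable_pfst; exact: computable_id.
    - by apply: computable_psnd; apply: computable_pred; do 2!apply: computable_psnd;
      exact: computable_id.
    - by apply: computable_psnd; exact: computable_id.
  by apply/funext => p; congr (nat_of_bool (_ == 0)); elim: (psnd p) => //= k ->.
move=> n; suff key s : iter (size s) (fun k => psnd k.-1) (string_code s) = 0 /\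
    forall j, j < size s -> iter j (fun k => psnd k.-1) (string_code s) != 0.
  by have := key (decode (f n)); rewrite decodeK => -[-> ?].
elim: s => [|x s [IH0 IHn]]; first by [].
split; first by rewrite [size _]/= iterSr /= psnd_pair.
by case=> [|j] //; rewrite ltnS iterSr /= psnd_pair => /IHn.
Qed.

(** A string code is built from the last entry backwards, hence the index [I n - i.+1] at stage
    [i]. *)
Lemma computable_mkseq (H : nat -> nat -> nat) I :
  comp (fun p => H (pfst p) (psnd p)) -> comp I ->
  comp (fun n => string_code (mkseq (H n) (I n))).
Proof.
move=> cH cI; rewrite (_ : (fun n => _) = fun n =>
    nat_rect (fun=> nat) 0 (fun i v => (pair_code (H n (I n - i.+1)) v).+1) (I n)).
  apply: computable_rec => //; first exact: computable_zero.
  apply: computable_S; apply: computable_pair; last by do 2!apply: computable_psnd;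
    exact: computable_id.
  pose q p := pair_code (pfst p) (I (pfst p) - (pfst (psnd p)).+1).
  rewrite (_ : (fun n => _) = fun p => H (pfst (q p)) (psnd (q p))); last first.
    by apply/funext => p; rewrite pfst_pair psnd_pair.
  apply: (computable_comp cH).
  apply: computable_pair; first by apply: computable_pfst; exact: computable_id.
  apply: computable_sub.
    by apply: computable_comp cI _; apply: computable_pfst; exact: computable_id.
  by apply: computable_S; apply: computable_pfst; apply: computable_psnd; exact: computable_id.
apply/funext => n.
suff {cH cI} H1 k : k <= I n -> string_code (map (H n) (iota (I n - k) k)) =
   nat_rect (fun=> nat) 0 (fun i v => (pair_code (H n (I n - i.+1)) v).+1) k.
  by rewrite -H1 // subnn.
elim: k => //= k IHk ltk; rewrite -IHk ?(ltnW ltk) //.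
by rewrite (_ : (I n - k.+1).+1 = I n - k) //; lia.
Qed.

End Computable.

Fixpoint relativize (d c : recfun) : recfun :=
  match c with
  | ROracle => d
  | RPair c1 c2 => RPair (relativize d c1) (relativize d c2)
  | RComp c1 c2 => RComp (relativize d c1) (relativize d c2)
  | RPrec c1 c2 => RPrec (relativize d c1) (relativize d c2)
  | RMu c1 => RMu (relativize d c1)
  | _ => c
  end.

Lemma computable_trans Z Z' f : computable_in Z Z' -> computable_in Z' f -> computable_in Z f.
Proof.
move=> [d dZ] [c cf]; exists (relativize d c) => n; move: (cf n) => {cf}.
elim: c n {f}(f n) => //=.
- by move=> n _ ->.
- move=> c1 IH1 c2 IH2 n m [m1 [m2 [/IH1 e1 /IH2 e2 em]]]; by exists m1, m2.
- by move=> c1 IH1 c2 IH2 n m [k [/IH2 e2 /IH1 e1]]; exists k.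
- move=> c1 IH1 c2 IH2 n m [s [/IH1 e1 e2 em]]; exists s; split=> // j /e2 /IH2 //.
- move=> c1 IH1 n m [/IH1 e1 e2]; split=> // j /e2 [k /IH1 ek]; by exists k.
Qed.


Lemma eval_in_fun Z c n m m' : eval_in Z c n m -> eval_in Z c n m' -> m = m'.
Proof.
elim: c n m m' => /=; try by move=> n m m' -> ->.
- move=> c1 IH1 c2 IH2 n m m' [a [b [a1 b1 ->]]] [a' [b' [a2 b2 ->]]].
  by rewrite (IH1 _ _ _ a1 a2) (IH2 _ _ _ b1 b2).
- move=> c1 IH1 c2 IH2 n m m' [k [ek em]] [k' [ek' em']].
  by move: em'; rewrite -(IH2 _ _ _ ek ek') => /(IH1 _ _ _ em).
- move=> c1 IH1 c2 IH2 n m m' [s [s0 sS ->]] [s' [s0' sS' ->]].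
  elim: (Cantor.of_nat n).2 sS sS' => [|i IHi] sS sS'; first exact: IH1 s0 s0'.
  have eqi : s i = s' i by apply: IHi => j ltj; [apply: sS | apply: sS']; exact: ltnW.
  by have := sS i (leqnn _); rewrite eqi => /IH2; apply; exact: sS'.
- move=> c1 IH1 n m m' [em ltm] [em' ltm'].
  case: (ltngtP m m') => // [/ltm' [k ek]|/ltm [k ek]].
    by have := IH1 _ _ _ em ek.
  by have := IH1 _ _ _ em' ek.
Qed.

(** * Functionals with real arguments *)

(* A sequence of real arguments; a number argument [n] is passed as the real [cst n]. *)
Definition env := nat -> nat -> nat.

Definition scons (Y : nat -> nat) (r : env) : env := fun i => if i is j.+1 then r j else Y.
Notation "Y .: r" := (scons Y r) (at level 60, right associativity).

Definition shift (r : env) : env := fun j => r j.+1.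
Definition cst (n : nat) : nat -> nat := fun=> n.

(** A finite syntax for functionals. Induction on it gives substitution, continuity and evaluation
    on finite parts of the arguments, and it makes the functionals enumerable. *)
Inductive tm := TLook of nat & tm | TApp of recfun & tm | TPair of tm & tm | TZero.

(* Codes of partial functions denote [0]. *)
Definition totfun (c : recfun) : nat -> nat :=
  if pselect (exists f, forall n, eval_in (fun=> 0) c n (f n)) is left h
  then projT1 (cid h) else fun=> 0.

Fixpoint teval (t : tm) (r : env) : nat :=
  match t with
  | TLook i t => r i (teval t r)
  | TApp c t => totfun c (teval t r)
  | TPair t1 t2 => pair_code (teval t1 r) (teval t2 r)
  | TZero => 0
  end.

Lemma computable_totfun c : computable_in (fun=> 0) (totfun c).
Proof.
rewrite /totfun; case: pselect => [h|_]; last exact: computable_zero.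
by case: (cid h) => f /= fP; exists c.
Qed.

Lemma totfun_surj f : computable_in (fun=> 0) f -> exists c, totfun c = f.
Proof.
move=> [c cf]; exists c; rewrite /totfun; case: pselect => [h|[]]; last by exists f.
by case: (cid h) => g /= cg; apply/funext => n; exact: eval_in_fun (cg n) (cf n).
Qed.

Definition tf (F : env -> nat) : Prop := exists t, forall r, F r = teval t r.

Lemma tf_look i F : tf F -> tf (fun r => r i (F r)).
Proof. by move=> [t tP]; exists (TLook i t) => r; rewrite tP. Qed.

Lemma tf_app f F : computable_in (fun=> 0) f -> tf F -> tf (fun r => f (F r)).
Proof.
move=> /totfun_surj[c cf] [t tP]; exists (TApp c t) => r.
by rewrite tP /= cf.
Qed.

Lemma tf_pair F G : tf F -> tf G -> tf (fun r => pair_code (F r) (G r)).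
Proof. by move=> [s sP] [t tP]; exists (TPair s t) => r; rewrite sP tP. Qed.

Lemma tf_const k : tf (fun=> k).
Proof.
have -> : (fun _ : env => k) = (fun r : env => cst k 0) by [].
by apply: (tf_app (f := cst k)); [exact: computable_const | exists TZero].
Qed.

Lemma tf_app2 g F G : computable_in (fun=> 0) (fun p => g (pfst p) (psnd p)) ->
  tf F -> tf G -> tf (fun r => g (F r) (G r)).
Proof.
move=> cg tF tG; rewrite (_ : (fun r => _) =
  fun r => g (pfst (pair_code (F r) (G r))) (psnd (pair_code (F r) (G r)))).
  exact: (tf_app cg (tf_pair tF tG)).
by apply/funext => r; rewrite pfst_pair psnd_pair.
Qed.

Lemma tf_let G K : tf G -> tf K -> tf (fun r => G (cst (K r) .: r)).
Proof.
move=> [t tP] tK; rewrite (_ : G = teval t); last exact/funext.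
elim: t {G tP} => [i t IH|c t IH|s IHs t IHt|] /=.
- by case: i => [|i] //=; exact: tf_look.
- by apply: tf_app => //; exact: computable_totfun.
- exact: tf_pair.
- by exists TZero.
Qed.

(** Each real of [G r] has to be definable as a function of its number argument. The premise passes
    this argument as the real in position 0, so that the original environment becomes [shift r]. *)
Lemma tf_sub F (G : env -> env) : tf F -> (forall i, tf (fun r => G (shift r) i (r 0 0))) ->
  tf (fun r => F (G r)).
Proof.
move=> [t tP] tG; rewrite (_ : F = teval t); last exact/funext.
elim: t {F tP} => [i t IH|c t IH|s IHs t IHt|] /=.
- exact: (tf_let (tG i) IH).
- by apply: tf_app => //; exact: computable_totfun.
- exact: tf_pair.
- by exists TZero.
Qed.

Lemma tf_shift F : tf F -> tf (fun r => F (shift r)).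
Proof. by move=> tF; apply: tf_sub => // i; apply: (tf_look i.+2);
  exact: (tf_look 0 (tf_const 0)). Qed.

Lemma tf_var i : tf (fun r => r i 0).
Proof. exact: tf_look (tf_const 0). Qed.

Lemma tf_S F : tf F -> tf (fun r => (F r).+1).
Proof. by apply: tf_app; apply: computable_S; exact: computable_id. Qed.

Lemma tf_pfst F : tf F -> tf (fun r => pfst (F r)).
Proof. by apply: tf_app; apply: computable_pfst; exact: computable_id. Qed.

Lemma tf_psnd F : tf F -> tf (fun r => psnd (F r)).
Proof. by apply: tf_app; apply: computable_psnd; exact: computable_id. Qed.

Lemma computable_pfst_id Z : computable_in Z pfst.
Proof. by apply: computable_pfst; exact: computable_id. Qed.

Lemma computable_psnd_id Z : computable_in Z psnd.
Proof. by apply: computable_psnd; exact: computable_id. Qed.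

Lemma tf_add F G : tf F -> tf G -> tf (fun r => F r + G r).
Proof.
by apply: tf_app2; apply: computable_add; [exact: computable_pfst_id | exact: computable_psnd_id].
Qed.

Lemma tf_leq F G : tf F -> tf G -> tf (fun r => F r <= G r).
Proof.
apply: (tf_app2 (g := fun x y => x <= y)).
by apply: computable_leq; [exact: computable_pfst_id | exact: computable_psnd_id].
Qed.

Lemma tf_eq F G : tf F -> tf G -> tf (fun r => F r == G r).
Proof.
apply: (tf_app2 (g := fun x y => x == y)).
by apply: computable_eq; [exact: computable_pfst_id | exact: computable_psnd_id].
Qed.

Lemma tf_neg (b : env -> bool) : tf b -> tf (fun r => ~~ b r).
Proof.
move=> tb; rewrite (_ : (fun r => _) = fun r => (b r == 0 :> nat) : nat).
  exact: tf_eq (tf_const 0).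
by apply/funext => r; case: (b r).
Qed.

Lemma tf_nth F G : tf F -> tf G -> tf (fun r => nth 0 (decode (F r)) (G r)).
Proof.
apply: (tf_app2 (g := fun x y => nth 0 (decode x) y)).
by apply: computable_nth; [exact: computable_pfst_id | exact: computable_psnd_id].
Qed.

Lemma tf_size F : tf F -> tf (fun r => size (decode (F r))).
Proof. by apply: (tf_app (f := fun x => size (decode x))); apply: computable_size;
  exact: computable_id. Qed.

Lemma tf_if (b : env -> bool) F G : tf b -> tf F -> tf G -> tf (fun r => if b r then F r else G r).
Proof.
move=> tb tF tG.
pose g x y := if x != 0 then pfst y else psnd y.
rewrite (_ : (fun r => _) = fun r => g (b r) (pair_code (F r) (G r))).
  apply: tf_app2 => //; last exact: tf_pair.
  rewrite /g; apply: computable_if.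
  - by apply: computable_neg; apply: computable_eq0; exact: computable_pfst_id.
  - by apply: computable_pfst; exact: computable_psnd_id.
  - by apply: computable_psnd; exact: computable_psnd_id.
by apply/funext => r; rewrite /g; case: (b r); rewrite ?pfst_pair ?psnd_pair.
Qed.

Lemma tf_or (b c : env -> bool) : tf b -> tf c -> tf (fun r => b r || c r).
Proof.
move=> tb tc; rewrite (_ : (fun r => _) = fun r => if b r then 1 else c r : nat).
  by apply: tf_if => //; exact: tf_const.
by apply/funext => r; case: (b r).
Qed.

(** A term makes finitely many queries. This continuity is what makes the forcing conditions below
    closed. *)
Lemma tf_cont F : tf F -> forall r, exists N, forall r',
  (forall i j, i < N -> j < N -> r' i j = r i j) -> F r' = F r.
Proof.
move=> [t tP] r; rewrite (_ : F = teval t); last exact/funext.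
elim: t {F tP} => [i t [N NP]|c t [N NP]|s [N NP] t [M MP]|] /=.
- exists (N + i + (teval t r)).+1 => r' eqr.
  rewrite (NP r') => [|a b lta ltb]; last by apply: eqr; lia.
  by apply: eqr; lia.
- by exists N => r' /NP ->.
- by exists (N + M) => r' eqr; rewrite (NP r') ?(MP r') // => a b lta ltb; apply: eqr; lia.
- by exists 0.
Qed.

(** * Sigma-1-1 relations *)

Definition sigma11 (A : env -> Prop) : Prop :=
  exists2 F, tf F & forall r, A r <-> exists Y, forall n, F (Y .: cst n .: r) = 0.

Lemma sig_ext A B : (forall r, A r <-> B r) -> sigma11 A -> sigma11 B.
Proof. by move=> eqAB [F tF FP]; exists F => // r; rewrite -eqAB. Qed.

Lemma sig_tf F : tf F -> sigma11 (fun r => F r = 0).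
Proof.
move=> tF; exists (fun r => F (shift (shift r))); first exact: (tf_shift (tf_shift tF)).
move=> r; split=> [F0|[Y /(_ 0)//]].
by exists (cst 0).
Qed.

Lemma sig_bool (b : env -> bool) : tf b -> sigma11 b.
Proof.
move=> tb; apply: sig_ext (sig_tf (tf_neg tb)) => r.
by case: (b r).
Qed.

Lemma sig_sub A (G : env -> env) : sigma11 A -> (forall i, tf (fun r => G (shift r) i (r 0 0))) ->
  sigma11 (fun r => A (G r)).
Proof.
move=> [F tF FP] tG; exists (fun r => F (r 0 .: r 1 .: G (shift (shift r)))).
  apply: (tf_sub (G := fun r => r 0 .: r 1 .: G (shift (shift r)))) => // -[|[|i]] /=.
  - exact: (tf_look 1 (tf_var 0)).
  - exact: (tf_look 2 (tf_var 0)).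
  - apply: (tf_sub (F := fun r => G (shift r) i (r 0 0)) (G := fun r =>
    r 0 .: shift (shift (shift r)))) => //.
    case=> [|j] /=; first exact: (tf_look 1 (tf_var 0)).
    exact: (tf_look j.+4 (tf_var 0)).
by move=> r; rewrite FP.
Qed.

Definition column (W : nat -> nat) (i : nat) : nat -> nat := fun k => W (pair_code i k).

Definition columns (V : nat -> nat -> nat) : nat -> nat := fun p => V (pfst p) (psnd p).

Lemma columnK V i : column (columns V) i = V i.
Proof. by apply/funext => k; rewrite /column /columns pfst_pair psnd_pair. Qed.

Lemma tf_column j i F : tf F -> tf (fun r => column (r j) i (F r)).
Proof. by move=> tF; apply: tf_look; apply: tf_pair => //; exact: tf_const. Qed.

(** Two real quantifiers are contracted into one, whose columns 0 and 1 hold the two witnesses. *)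
Lemma sig_exR (B : env -> (nat -> nat) -> Prop) :
  sigma11 (fun r => B (shift r) (r 0)) -> sigma11 (fun r => exists Z, B r Z).
Proof.
move=> [F tF FP]; exists (fun r => F (column (r 0) 0 .: r 1 .: column (r 0) 1 .: shift (shift r))).
  apply: (tf_sub (G := fun r => column (r 0) 0 .: r 1 .: column (r 0) 1 .: shift (shift r))) =>
    // -[|[|[|i]]] /=.
  - exact: (tf_column 1 0 (tf_var 0)).
  - exact: (tf_look 2 (tf_var 0)).
  - exact: (tf_column 1 1 (tf_var 0)).
  - exact: (tf_look i.+3 (tf_var 0)).
move=> r; split=> [[Z /(FP (Z .: r))[Y YP]]|[W WP]].
  by exists (columns (fun i => if i is 0 then Y else Z)) => n; rewrite /= !columnK.
exists (column W 1); apply/(FP (column W 1 .: r)).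
by exists (column W 0) => n; exact: WP.
Qed.

Lemma sig_exN (B : env -> nat -> Prop) :
  sigma11 (fun r => B (shift r) (r 0 0)) -> sigma11 (fun r => exists n, B r n).
Proof.
move=> sB; apply: sig_ext (sig_exR (B := fun r Z => B r (Z 0)) sB) => r.
by split=> [[Z BZ]|[n Bn]]; [exists (Z 0) | exists (cst n)].
Qed.

(** Countable choice collects the witnesses for all [n] as the columns of one real; the two number
    quantifiers then merge by pairing. *)
Lemma sig_allN (B : env -> nat -> Prop) :
  sigma11 (fun r => B (shift r) (r 0 0)) -> sigma11 (fun r => forall n, B r n).
Proof.
move=> [F tF FP].
exists (fun r => F ((fun k => r 0 (pair_code (pfst (r 1 0)) k)) .: cst (psnd (r 1 0)) .:
                    cst (pfst (r 1 0)) .: shift (shift r))).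
  apply: (tf_sub (G := fun r => (fun k => r 0 (pair_code (pfst (r 1 0)) k)) .: cst (psnd (r 1 0)) .:
                    cst (pfst (r 1 0)) .: shift (shift r))) => // -[|[|[|i]]] /=.
  - by apply: (tf_look 1); apply: tf_pair; [apply: tf_pfst; exact: (tf_var 2) | exact: (tf_var 0)].
  - by apply: tf_psnd; exact: (tf_var 2).
  - by apply: tf_pfst; exact: (tf_var 2).
  - exact: (tf_look i.+3 (tf_var 0)).
move=> r; split=> [allB|[W WP] n].
  have /choice[V VP] n : exists Y, forall m, F (Y .: cst m .: cst n .: r) = 0.
    exact/(FP (cst n .: r))/allB.
  exists (columns V) => n; rewrite /=.
  rewrite (_ : (fun k => _) = V (pfst n)) /cst; first exact: VP.
  by rewrite -(columnK V (pfst n)).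
apply/(FP (cst n .: r)); exists (column W n) => m.
by have := WP (pair_code n m); rewrite /= /cst pfst_pair psnd_pair.
Qed.

Lemma sig_and A B : sigma11 A -> sigma11 B -> sigma11 (fun r => A r /\ B r).
Proof.
move=> [F tF FP] [G tG GP].
pose q i (r : env) := column (r 0) i .: r 1 .: shift (shift r).
have tq i H : tf H -> tf (fun r => H (q i r)).
  move=> tH; apply: tf_sub => // -[|[|j]] /=.
  - exact: (tf_column 1 i (tf_var 0)).
  - exact: (tf_look 2 (tf_var 0)).
  - exact: (tf_look j.+3 (tf_var 0)).
exists (fun r => F (q 0 r) + G (q 1 r)); first by apply: tf_add; exact: tq.
move=> r; split=> [[/FP[Y YP] /GP[Z ZP]]|[W WP]].
  exists (columns (fun i => if i is 0 then Y else Z)) => n.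
  by rewrite /q /= !columnK; apply/eqP; rewrite addn_eq0 YP ZP.
split; [apply/FP; exists (column W 0) => n | apply/GP; exists (column W 1) => n].
  by have := WP n => /eqP; rewrite addn_eq0 => /andP[/eqP].
by have := WP n => /eqP; rewrite addn_eq0 => /andP[_ /eqP].
Qed.

(** The first value of column 0 tells which disjunct holds, and column 1 is its witness. *)
Lemma sig_or A B : sigma11 A -> sigma11 B -> sigma11 (fun r => A r \/ B r).
Proof.
move=> [F tF FP] [G tG GP].
pose q i (r : env) := column (r 0) i .: r 1 .: shift (shift r).
have tq i H : tf H -> tf (fun r => H (q i r)).
  move=> tH; apply: tf_sub => // -[|[|j]] /=.
  - exact: (tf_column 1 i (tf_var 0)).
  - exact: (tf_look 2 (tf_var 0)).
  - exact: (tf_look j.+3 (tf_var 0)).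
exists (fun r => if column (r 0) 0 0 == 0 then F (q 1 r) else G (q 1 r)).
  apply: tf_if; [|exact: tq..].
  by apply: tf_eq; [exact: (tf_column 0 0 (tf_const 0)) | exact: tf_const].
move=> r; split=> [[/FP[Y YP]|/GP[Y YP]]|[W WP]].
- by exists (columns (fun i => if i is 0 then cst 0 else Y)) => n; rewrite /q /= !columnK /=.
- by exists (columns (fun i => if i is 0 then cst 1 else Y)) => n; rewrite /q /= !columnK /=.
- case: (eqVneq (column W 0 0) 0) => [W0|/negPf W0].
    by left; apply/FP; exists (column W 1) => n; have := WP n; rewrite /= W0.
  by right; apply/GP; exists (column W 1) => n; have := WP n; rewrite /= W0.
Qed.

(** Arithmetical formulas are treated in this class because it is closed under negation, hence under
    implication, as well as under number quantifiers. *)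
Definition delta11 (A : env -> Prop) : Prop := sigma11 A /\ sigma11 (fun r => ~ A r).

Lemma del_ext A B : (forall r, A r <-> B r) -> delta11 A -> delta11 B.
Proof. by move=> eqAB [sA snA]; split; [apply: sig_ext sA | apply: sig_ext snA] => r;
  rewrite eqAB. Qed.

Lemma del_bool (b : env -> bool) : tf b -> delta11 b.
Proof.
move=> tb; split; first exact: sig_bool.
by apply: sig_ext (sig_bool (tf_neg tb)) => r; split=> /negP.
Qed.

Lemma del_eq F G : tf F -> tf G -> delta11 (fun r => F r = G r).
Proof. by move=> tF tG; apply: del_ext (del_bool (tf_eq tF tG)) => r; split=> /eqP. Qed.

Lemma del_not A : delta11 A -> delta11 (fun r => ~ A r).
Proof. by move=> [sA snA]; split=> //; apply: sig_ext sA => r; rewrite notK. Qed.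

Lemma del_and A B : delta11 A -> delta11 B -> delta11 (fun r => A r /\ B r).
Proof.
move=> [sA snA] [sB snB]; split; first exact: sig_and.
by apply: sig_ext (sig_or snA snB) => r; rewrite not_andE.
Qed.

Lemma del_or A B : delta11 A -> delta11 B -> delta11 (fun r => A r \/ B r).
Proof.
move=> [sA snA] [sB snB]; split; first exact: sig_or.
by apply: sig_ext (sig_and snA snB) => r; rewrite not_orE.
Qed.

Lemma del_imp A B : delta11 A -> delta11 B -> delta11 (fun r => A r -> B r).
Proof.
move=> dA dB; apply: del_ext (del_or (del_not dA) dB) => r.
by rewrite implyE.
Qed.

Lemma del_exN (B : env -> nat -> Prop) :
  delta11 (fun r => B (shift r) (r 0 0)) -> delta11 (fun r => exists n, B r n).
Proof.
move=> [sB snB]; split; first exact: sig_exN.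
apply: sig_ext (sig_allN (B := fun r n => ~ B r n) snB) => r.
by rewrite -forallNE.
Qed.

Lemma del_allN (B : env -> nat -> Prop) :
  delta11 (fun r => B (shift r) (r 0 0)) -> delta11 (fun r => forall n, B r n).
Proof.
move=> [sB snB]; split; first exact: sig_allN.
apply: sig_ext (sig_exN (B := fun r n => ~ B r n) snB) => r.
by rewrite -existsNE.
Qed.

Lemma del_exS (B : env -> seq nat -> Prop) :
  delta11 (fun r => B (shift r) (decode (r 0 0))) -> delta11 (fun r => exists s, B r s).
Proof.
move=> dB; apply: del_ext (del_exN (B := fun r n => B r (decode n)) dB) => r.
by split=> [[n]|[s]]; [exists (decode n) | exists (string_code s); rewrite string_codeK].
Qed.

Lemma del_allS (B : env -> seq nat -> Prop) :
  delta11 (fun r => B (shift r) (decode (r 0 0))) -> delta11 (fun r => forall s, B r s).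
Proof.
move=> dB; apply: del_ext (del_allN (B := fun r n => B r (decode n)) dB) => r.
by split=> B_ s //; have := B_ (string_code s); rewrite string_codeK.
Qed.

(** Boolean strings represent finite sets of numbers. Quantifiers over them are reduced to numerical
    strings, since [bits] is onto. *)
Definition bits (s : seq nat) : seq bool := map (fun x => x != 0) s.

Lemma nth_bits s j : nth false (bits s) j = (nth 0 s j != 0).
Proof.
case: (ltnP j (size s)) => [ltj|lej]; first by rewrite (nth_map 0).
by rewrite !nth_default ?size_map.
Qed.

Lemma bits_surj (w : seq bool) : exists s, bits s = w.
Proof.
exists (map nat_of_bool w); rewrite /bits -map_comp -[RHS]map_id.
by apply: eq_map => -[].
Qed.

Lemma del_allB (B : env -> seq bool -> Prop) :
  delta11 (fun r => B (shift r) (bits (decode (r 0 0)))) -> delta11 (fun r => forall w, B r w).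
Proof.
move=> dB; apply: del_ext (del_allS (B := fun r s => B r (bits s)) dB) => r.
by split=> B_ // w; have [s <-] := bits_surj w.
Qed.


(** * Sigma-1-1 relations are projections of computable trees *)

Definition zenv : env := fun _ _ => 0.

Definition plook (u : seq nat) (p : nat) : nat := if p < size u then (nth 0 u p).+1 else 0.

(* Evaluation in [Y .: cst n .: Z .: zenv], where only an initial segment [u] of
   [oplus Z Y] is known; [0] means undefined, and [v.+1] means the value [v]. *)
Fixpoint peval (t : tm) (u : seq nat) (n : nat) : nat :=
  match t with
  | TLook i t =>
      if peval t u n is v.+1 then
        match i with
        | 0 => plook u v.*2.+1 | 1 => n.+1 | 2 => plook u v.*2 | _ => 1
        end
      else 0
  | TApp c t => if peval t u n is v.+1 then (totfun c v).+1 else 0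
  | TPair t1 t2 =>
      if peval t1 u n is v1.+1 then
        if peval t2 u n is v2.+1 then (pair_code v1 v2).+1 else 0
      else 0
  | TZero => 1
  end.

Lemma plook_prefix s u p v : prefix s u -> plook s p = v.+1 -> plook u p = v.+1.
Proof.
move=> /prefixP[s' ->]; rewrite /plook size_cat nth_cat.
by case: ltnP => // lt_ps [->]; rewrite ltn_addr.
Qed.

Lemma peval_prefix t s u n v : prefix s u -> peval t s n = v.+1 -> peval t u n = v.+1.
Proof.
move=> su; elim: t v => //= [i t IH|c t IH|t1 IH1 t2 IH2] v.
- case: (peval t s n) IH => // w /(_ w erefl) ->.
  by case: i => [|[|[|i]]] //; exact: plook_prefix.
- by case: (peval t s n) IH => // w /(_ w erefl) ->.
- case: (peval t1 s n) IH1 => // w /(_ w erefl) ->.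
  by case: (peval t2 s n) IH2 => // w2 /(_ w2 erefl) ->.
Qed.

Lemma plook_mkseq W m p : plook (mkseq W m) p = if p < m then (W p).+1 else 0.
Proof. by rewrite /plook size_mkseq; case: ltnP => // lt_pm; rewrite nth_mkseq. Qed.

Lemma oplus_odd Z Y k : oplus Z Y k.*2.+1 = Y k.
Proof. by rewrite /oplus /= odd_double uphalf_double. Qed.

Lemma oplus_even Z Y k : oplus Z Y k.*2 = Z k.
Proof. by rewrite /oplus odd_double doubleK. Qed.

Lemma peval_sound t Z Y n m v : peval t (mkseq (oplus Z Y) m) n = v.+1 ->
  teval t (Y .: cst n .: Z .: zenv) = v.
Proof.
elim: t v => //= [i t IH|c t IH|t1 IH1 t2 IH2|] v; last by case.
- case: (peval t _ n) IH => // w /(_ w erefl) ->.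
  case: i => [|[|[|i]]] /=; rewrite ?plook_mkseq; last by case.
  + by case: ltnP => // _ []; rewrite oplus_odd.
  + by case.
  + by case: ltnP => // _ []; rewrite oplus_even.
- by case: (peval t _ n) IH => // w /(_ w erefl) -> [].
- case: (peval t1 _ n) IH1 => // w /(_ w erefl) ->.
  by case: (peval t2 _ n) IH2 => // w2 /(_ w2 erefl) -> [].
Qed.

Lemma peval_complete t Z Y n : exists M, forall m, M <= m ->
  peval t (mkseq (oplus Z Y) m) n = (teval t (Y .: cst n .: Z .: zenv)).+1.
Proof.
elim: t => /= [i t [M MP]|c t [M MP]|t1 [M1 M1P] t2 [M2 M2P]|]; last by exists 0.
(* A query at [v] reads entry [v.*2] or [v.*2.+1] of the join, and both are below [v.+1.*2]. *)
- exists (M + (teval t (Y .: cst n .: Z .: zenv)).+1.*2) => m lem.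
  rewrite MP; last by lia.
  case: i => [|[|[|i]]] //; rewrite plook_mkseq ifT ?oplus_odd ?oplus_even //; lia.
- by exists M => m /MP ->.
- by exists (M1 + M2) => m lem; rewrite M1P ?M2P //; lia.
Qed.

Lemma computable_plook F G : computable_in (fun=> 0) F -> computable_in (fun=> 0) G ->
  computable_in (fun=> 0) (fun p => plook (decode (F p)) (G p)).
Proof.
move=> cF cG; apply: (@computable_if _ (fun p => G p < size (decode (F p)))).
- apply: computable_leq; first exact: computable_S.
  exact: computable_size.
- by apply: computable_S; exact: computable_nth.
- exact: computable_const.
Qed.

Lemma computable_double Z f : computable_in Z f -> computable_in Z (fun n => (f n).*2).
Proof.
move=> cf; rewrite (_ : (fun n => _) = fun n => f n + f n); first exact: computable_add.
by apply/funext => n; rewrite addnn.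
Qed.

Lemma computable_case Z f g : computable_in Z f -> computable_in Z (fun n => g n (f n).-1) ->
  computable_in Z (fun n => if f n is v.+1 then g n v else 0).
Proof.
move=> cf cg; rewrite (_ : (fun n => _) = fun n => if f n == 0 then 0 else g n (f n).-1).
  by apply: computable_if => //; [exact: computable_eq0 | exact: computable_const].
by apply/funext => n; case: (f n).
Qed.

Lemma computable_peval t :
  computable_in (fun=> 0) (fun p => peval t (decode (pfst p)) (psnd p)).
Proof.
have c1 := computable_pfst_id (fun=> 0); have c2 := computable_psnd_id (fun=> 0).
elim: t => /= [i t IH|c t IH|t1 IH1 t2 IH2|]; last exact: computable_const.
- case: i => [|[|[|i]]].
  + apply: (computable_case (g := fun p v => plook (decode (pfst p)) v.*2.+1)) => //.
    apply: computable_plook => //; apply: computable_S; apply: computable_double.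
    exact: computable_pred.
  + by apply: (computable_case (g := fun p v => (psnd p).+1)) => //; exact: computable_S.
  + apply: (computable_case (g := fun p v => plook (decode (pfst p)) v.*2)) => //.
    by apply: computable_plook => //; apply: computable_double; exact: computable_pred.
  + by apply: (computable_case (g := fun p v => 1)) => //; exact: computable_const.
- apply: (computable_case (g := fun p v => (totfun c v).+1)) => //; apply: computable_S.
  by apply: computable_comp; [exact: computable_totfun | exact: computable_pred].
- apply: (computable_case (g := fun p v1 => if peval t2 (decode (pfst p)) (psnd p) is v2.+1
    then (pair_code v1 v2).+1 else 0)) => //.
  apply: (computable_case (g := fun p v2 =>
    (pair_code (peval t1 (decode (pfst p)) (psnd p)).-1 v2).+1)) => //.
  by apply: computable_S; apply: computable_pair; exact: computable_pred.
Qed.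

(** The tree keeps the strings on which no [n] below the length is yet known to have a non-zero
    value: [peval t u n <= 1] means undefined or equal to 0. The bound on [n] makes this decidable,
    and a path checks every [n] in the limit. *)
Lemma sig_Sigma11 A : sigma11 A -> Sigma11 [set Z | A (Z .: zenv)].
Proof.
move=> [F [t /funext->] FP].
pose T := [set u : seq nat | forall n, n < size u -> peval t u n <= 1].
exists T; split.
- move=> s u su Tu n lt_n; case E: (peval t s n) => [|v] //.
  by rewrite -(peval_prefix su E) Tu // (leq_trans lt_n) // size_prefix.
- exists (fun k => all (fun n => peval t (decode k) n <= 1) (iota 0 (size (decode k)))).
    apply: (@computable_all _ (fun k n => peval t (decode k) n <= 1)).
      by apply: computable_leq; [exact: computable_peval | exact: computable_const].
    exact: (computable_size (f := id) (computable_id _)).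
  move=> u; rewrite string_codeK; congr nat_of_bool; apply/idP/asboolP.
    by move=> /allP H n lt_n; apply: H; rewrite mem_iota.
  by move=> H; apply/allP => n; rewrite mem_iota => /H.
- apply/seteqP; split=> Z /=.
    move=> /FP[Y YP]; exists Y => m n _.
    by case E: (peval _ _ _) => [|v] //; rewrite -(peval_sound E) YP.
  move=> [Y YP]; apply/FP; exists Y => n.
  have [M MP] := peval_complete t Z Y n.
  have := YP (M + n.+1) n; rewrite MP ?leq_addr // size_mkseq.
  by move=> H; apply/eqP; rewrite -leqn0 -ltnS H //; lia.
Qed.


(** * Computations with a partial oracle *)

(* As [eval_in], but the oracle is a partial function given by its graph, and the
   successive values in a primitive recursion form a finite sequence: this makes the
   relation arithmetical. *)
Fixpoint pev (Q : nat -> nat -> Prop) (c : recfun) (n m : nat) : Prop :=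
  match c with
  | RZero => m = 0
  | RSucc => m = n.+1
  | RFst => m = pfst n
  | RSnd => m = psnd n
  | ROracle => Q n m
  | RPair c1 c2 => exists m1 m2, (pev Q c1 n m1 /\ pev Q c2 n m2) /\ m = pair_code m1 m2
  | RComp c1 c2 => exists k, pev Q c2 n k /\ pev Q c1 k m
  | RPrec c1 c2 => exists s : seq nat,
      (pev Q c1 (pfst n) (nth 0 s 0) /\
       forall j, j < psnd n ->
         pev Q c2 (pair_code (pfst n) (pair_code j (nth 0 s j))) (nth 0 s j.+1))
      /\ m = nth 0 s (psnd n)
  | RMu c1 => pev Q c1 (pair_code n m) 0 /\
      forall j, j < m -> exists k, pev Q c1 (pair_code n j) k.+1
  end.

Lemma pev_mono (Q Q' : nat -> nat -> Prop) c n m :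
  (forall x y, Q x y -> Q' x y) -> pev Q c n m -> pev Q' c n m.
Proof.
move=> QQ'; elim: c n m => //=.
- by move=> c1 IH1 c2 IH2 n m [m1 [m2 [[/IH1 e1 /IH2 e2] ->]]]; exists m1, m2.
- by move=> c1 IH1 c2 IH2 n m [k [/IH2 e2 /IH1 e1]]; exists k.
- by move=> c1 IH1 c2 IH2 n m [s [[/IH1 e1 e2] ->]]; exists s; do 2!split=> //; move=> j /e2 /IH2.
- by move=> c1 IH1 n m [/IH1 e1 e2]; split=> // j /e2[k /IH1]; exists k.
Qed.

Lemma pev_eval Z (Q : nat -> nat -> Prop) c n m :
  (forall x y, Q x y -> y = Z x) -> pev Q c n m -> eval_in Z c n m.
Proof.
move=> QZ; elim: c n m => //=.
- by move=> c1 IH1 c2 IH2 n m [m1 [m2 [[/IH1 e1 /IH2 e2] ->]]]; exists m1, m2.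
- by move=> c1 IH1 c2 IH2 n m [k [/IH2 e2 /IH1 e1]]; exists k.
- move=> c1 IH1 c2 IH2 n m [s [[/IH1 e1 e2] ->]]; exists (nth 0 s).
  by split=> // j /e2 /IH2.
- by move=> c1 IH1 n m [/IH1 e1 e2]; split=> // j /e2[k /IH1]; exists k.
Qed.

Lemma bounded_choice (P : nat -> nat -> Prop) i :
  (forall j k k', k <= k' -> P j k -> P j k') ->
  (forall j, j < i -> exists k, P j k) -> exists k, forall j, j < i -> P j k.
Proof.
move=> mono; elim: i => [|i IHi] exP; first by exists 0.
have [k kP] : exists k, forall j, j < i -> P j k.
  by apply: IHi => j lt_j; exact: exP (ltnW lt_j).
have [k' k'P] := exP i (leqnn _).
exists (maxn k k') => j; rewrite ltnS leq_eqVlt => /predU1P[->|/kP].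
  exact: mono (leq_maxr _ _) k'P.
exact: mono (leq_maxl _ _).
Qed.

(** The use principle: a converging computation consults only finitely many oracle values, and the
    bounds of its parts are combined by monotonicity. *)
Lemma eval_pev Z c n m : eval_in Z c n m -> exists k, pev (fun x y => x < k /\ y = Z x) c n m.
Proof.
have mono c' n' m' k k' : k <= k' ->
    pev (fun x y => x < k /\ y = Z x) c' n' m' -> pev (fun x y => x < k' /\ y = Z x) c' n' m'.
  by move=> lek; apply: pev_mono => x y [ltx ->]; rewrite (leq_trans ltx).
elim: c n m => //=; try by move=> n m ->; exists 0.
- by move=> n m ->; exists n.+1.
- move=> c1 IH1 c2 IH2 n m [m1 [m2 [/IH1[k1 e1] /IH2[k2 e2] ->]]]; exists (maxn k1 k2), m1, m2.
  by split=> //; split; [apply: mono e1; exact: leq_maxl | apply: mono e2; exact: leq_maxr].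
- move=> c1 IH1 c2 IH2 n m [i [/IH2[k2 e2] /IH1[k1 e1]]]; exists (maxn k1 k2), i.
  by split; [apply: mono e2; exact: leq_maxr | apply: mono e1; exact: leq_maxl].
- move=> c1 IH1 c2 IH2 n m [s [/IH1[k1 e1] e2 ->]].
  have [k2 k2P] : exists k, forall j, j < psnd n -> pev (fun x y => x < k /\ y = Z x) c2
      (pair_code (pfst n) (pair_code j (s j))) (s j.+1).
    apply: bounded_choice; first by move=> j k k' /mono H /H.
    by move=> j /e2 /IH2.
  exists (maxn k1 k2), (mkseq s (psnd n).+1); split; last by rewrite nth_mkseq.
  split=> [|j lt_j]; first by rewrite nth_mkseq //; apply: mono e1; exact: leq_maxl.
  rewrite !nth_mkseq ?ltnS ?(ltnW lt_j) //.
  by apply: mono (k2P j lt_j); exact: leq_maxr.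
- move=> c1 IH1 n m [/IH1[k1 e1] e2].
  have [k2 k2P] : exists k, forall j, j < m -> exists v, pev (fun x y => x < k /\ y = Z x) c1
      (pair_code n j) v.+1.
    apply: bounded_choice; first by move=> j k k' /mono H [v /H]; exists v.
    by move=> j /e2[v /IH1[k kP]]; exists k, v.
  exists (maxn k1 k2); split; first by apply: mono e1; exact: leq_maxl.
  by move=> j /k2P[v vP]; exists v; apply: mono vP; exact: leq_maxr.
Qed.

Lemma del_lt F G : tf F -> tf G -> delta11 (fun r => F r < G r).
Proof. by move=> tF tG; apply: del_bool; apply: tf_leq => //; exact: tf_S. Qed.

(** By induction on the code, as every clause of [pev] quantifies over numbers and strings only. The
    partial oracle may vary with a number [K r], later the code of a finite set. *)
Lemma del_pev (Q : nat -> nat -> nat -> Prop) c :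
  (forall K N M, tf K -> tf N -> tf M -> delta11 (fun r => Q (K r) (N r) (M r))) ->
  forall K N M, tf K -> tf N -> tf M -> delta11 (fun r => pev (Q (K r)) c (N r) (M r)).
Proof.
move=> dQ; elim: c => /=.
- by move=> K N M tK tN tM; apply: del_eq => //; exact: tf_const.
- by move=> K N M tK tN tM; apply: del_eq => //; exact: tf_S.
- by move=> K N M tK tN tM; apply: del_eq => //; exact: tf_pfst.
- by move=> K N M tK tN tM; apply: del_eq => //; exact: tf_psnd.
- exact: dQ.
- move=> c1 IH1 c2 IH2 K N M tK tN tM; apply: del_exN; apply: del_exN.
  have tK' := tf_shift (tf_shift tK); have tN' := tf_shift (tf_shift tN).
  have tM' := tf_shift (tf_shift tM).
  have t1 : tf (fun r => shift r 0 0) := tf_var 1.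
  apply: del_and; last by apply: del_eq => //; apply: tf_pair => //; exact: tf_var.
  by apply: del_and; [apply: IH1 | apply: IH2] => //; exact: tf_var.
- move=> c1 IH1 c2 IH2 K N M tK tN tM; apply: del_exN.
  have tK' := tf_shift tK; have tN' := tf_shift tN; have tM' := tf_shift tM.
  by apply: del_and; [apply: IH2 | apply: IH1] => //; exact: tf_var.
- move=> c1 IH1 c2 IH2 K N M tK tN tM; apply: del_exS.
  have tK' := tf_shift tK; have tN' := tf_shift tN; have tM' := tf_shift tM.
  apply: del_and; last first.
    by apply: del_eq => //; apply: tf_nth; [exact: tf_var | exact: tf_psnd].
  apply: del_and.
    by apply: IH1 => //; [exact: tf_pfst | apply: tf_nth; [exact: tf_var | exact: tf_const]].
  have tK2 := tf_shift tK'; have tN2 := tf_shift tN'.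
  have t1 : tf (fun r => shift r 0 0) := tf_var 1.
  have t0 : tf (fun r => r 0 0) := tf_var 0.
  apply: del_allN; apply: del_imp; first by apply: del_lt => //; exact: tf_psnd.
  apply: IH2 => //; last by apply: tf_nth => //; exact: tf_S.
  by apply: tf_pair; [exact: tf_pfst | apply: tf_pair => //; exact: tf_nth].
- move=> c1 IH1 K N M tK tN tM.
  have tK' := tf_shift tK; have tN' := tf_shift tN; have tM' := tf_shift tM.
  have tK2 := tf_shift tK'; have tN2 := tf_shift tN'.
  have t1 : tf (fun r => shift r 0 0) := tf_var 1.
  have t0 : tf (fun r => r 0 0) := tf_var 0.
  apply: del_and; first by apply: IH1 => //; [exact: tf_pair | exact: tf_const].
  apply: del_allN; apply: del_imp; first exact: del_lt.
  by apply: del_exN; apply: IH1 => //; [exact: tf_pair | exact: tf_S].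
Qed.


(** * Compactness *)

Lemma mkseqS_rcons (T : Type) (f : nat -> T) n : mkseq f n.+1 = rcons (mkseq f n) (f n).
Proof. by rewrite /mkseq -addn1 iotaD map_cat /= add0n cats1. Qed.

Lemma seq_path (x0 : nat) (P : seq nat -> Prop) :
  P [::] -> (forall s, P s -> exists x, P (rcons s x)) ->
  exists Z : nat -> nat, forall n, P (mkseq Z n).
Proof.
move=> P0 PS.
have /choice[nxt nxtP] s : exists x, P s -> P (rcons s x).
  by case: (pselect (P s)) => [/PS[x]|nP]; [exists x | exists x0].
pose fix pre n := if n is m.+1 then rcons (pre m) (nxt (pre m)) else [::].
exists (fun n => nxt (pre n)) => n.
suff -> : mkseq (fun n => nxt (pre n)) n = pre n by elim: n => //= n /nxtP.
by elim: n => // n IHn; rewrite mkseqS_rcons IHn.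
Qed.

(** The path goes through strings with arbitrarily long extensions in [T]. If no child of such a
    string were of this kind, the finitely many children allowed by [b] would have a common bound on
    the lengths of their extensions. *)
Lemma konig (T : set (seq nat)) (b : nat -> nat) : is_tree T ->
  (forall s x, T s -> x < size s -> nth 0 s x <= b x) ->
  (forall l, exists s, T s /\ l <= size s) -> exists Z : baire, paths T Z.
Proof.
move=> treeT bT exT.
pose big s := forall l, exists t, [/\ T t, prefix s t & l <= size t].
have [] := @seq_path 0 big.
- by move=> l; have [t [Tt le_t]] := exT l; exists t; split=> //; exact: prefix0s.
- move=> s bigs; apply: contrapT => /forallNP nbig.
  have [l lP] : exists l, forall x, x < (b (size s)).+1 ->
      forall t, T t -> prefix (rcons s x) t -> size t < l.
    apply: bounded_choice => [x k k' lek H t Tt pt|x _].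
      exact: leq_trans (H t Tt pt) lek.
    have /existsNP[l lP] := nbig x; exists l => t Tt pt.
    by rewrite ltnNge; apply/negP => le_t; apply: lP; exists t.
  have [t [Tt pst let_]] := bigs (maxn l (size s).+1).
  have ltst : size s < size t by apply: leq_trans let_; exact: leq_maxr.
  have : size t < l.
    apply: (lP (nth 0 t (size s))); rewrite ?ltnS //; first exact: bT.
    have /prefixP[t' et] := pst; rewrite et nth_cat ltnn subnn.
    case: t' et => [|x t'] et; first by move: ltst; rewrite et cats0 ltnn.
    by rewrite -cat_rcons prefix_prefix.
  by rewrite ltnNge (leq_trans (leq_maxl _ _) let_).
- move=> Z ZP; exists Z => n; have [t [Tt pt _]] := ZP n 0.
  exact: treeT pt Tt.
Qed.

Definition extends (Z : nat -> nat) (s : seq nat) : Prop :=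
  forall j, j < size s -> Z j = nth 0 s j.

Lemma extends_mkseq Z Z' n : extends Z (mkseq Z' n) <-> forall j, j < n -> Z j = Z' j.
Proof.
rewrite /extends size_mkseq.
by split=> H j ltj; have := H j ltj; rewrite nth_mkseq.
Qed.

(** * Finite evidence that a computably bounded closed set misses a cylinder *)

(** What is known of the oracle when [w] is an initial segment of a set and the finite set [h] is
    added to it: only the values below [size w]. *)
Definition info (h w : seq bool) (x y : nat) : Prop :=
  x < size w /\ y = nth false h x || nth false w x.

(** The evidence is a level at least the length of [s], the values [bs] of the bound below this
    level and, for each string [t] of this level within the bounds and extending [s], an initial
    segment [u] that the computation has rejected. It is arithmetical and survives lengthening of
    [w]. *)
Definition seen (cT cb : recfun) (h w : seq bool) (s : seq nat) : Prop :=
  exists bs : seq nat,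
    (size s <= size bs /\ forall j, j < size bs -> pev (info h w) cb j (nth 0 bs j)) /\
    forall t : seq nat,
      ((size t = size bs /\ forall j, j < size t -> nth 0 t j <= nth 0 bs j) /\
       extends (nth 0 t) s) ->
      exists u : seq nat,
        (size u <= size t /\ forall j, j < size u -> nth 0 u j = nth 0 t j) /\
        pev (info h w) cT (string_code u) 0.

Lemma del_info h K N M : tf K -> tf N -> tf M ->
  delta11 (fun r => info h (bits (decode (K r))) (N r) (M r)).
Proof.
move=> tK tN tM; have [s <-] := bits_surj h; rewrite /info.
apply: (del_ext (A := fun r => N r < size (decode (K r)) /\
   M r = (nth 0 (decode (string_code s)) (N r) != 0) || (nth 0 (decode (K r)) (N r) != 0))).
  by move=> r; rewrite size_map !nth_bits string_codeK.
have tnth F : tf F -> tf (fun r => nth 0 (decode (F r)) (N r) != 0).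
  by move=> tF; apply: (@tf_neg (fun r => nth 0 (decode (F r)) (N r) == 0)); apply: tf_eq;
    [exact: tf_nth | exact: tf_const].
apply: del_and; first by apply: del_lt => //; exact: tf_size.
apply: del_eq => //.
apply: (@tf_or (fun r => nth 0 (decode (string_code s)) (N r) != 0)
   (fun r => nth 0 (decode (K r)) (N r) != 0)).
  by apply: (tnth (fun=> _)); exact: tf_const.
exact: tnth.
Qed.

Lemma del_leq F G : tf F -> tf G -> delta11 (fun r => F r <= G r).
Proof. by move=> tF tG; apply: del_bool; exact: tf_leq. Qed.

Lemma del_pev_info h c K N M : tf K -> tf N -> tf M ->
  delta11 (fun r => pev (info h (bits (decode (K r)))) c (N r) (M r)).
Proof. by apply: (@del_pev (fun k => info h (bits (decode k)))) => *; exact: del_info. Qed.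

Lemma del_extends_nth K S : tf K -> tf S ->
  delta11 (fun r => extends (nth 0 (decode (K r))) (decode (S r))).
Proof.
move=> tK tS; apply: del_allN.
have tK1 := tf_shift tK; have tS1 := tf_shift tS; have t0 := tf_var 0.
apply: del_imp; first by apply: del_lt => //; exact: tf_size.
by apply: del_eq; exact: tf_nth.
Qed.

Lemma del_seen cT cb h K S : tf K -> tf S ->
  delta11 (fun r => seen cT cb h (bits (decode (K r))) (decode (S r))).
Proof.
move=> tK tS; apply: del_exS.
have tK1 := tf_shift tK; have tS1 := tf_shift tS; have t0 := tf_var 0.
have t1 : tf (fun r => shift r 0 0) := tf_var 1.
have tK2 := tf_shift tK1; have tS2 := tf_shift tS1.
apply: del_and; first apply: del_and.
- by apply: del_leq; exact: tf_size.
- apply: del_allN; apply: del_imp; first by apply: del_lt => //; exact: tf_size.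
  by apply: del_pev_info => //; exact: tf_nth.
- apply: del_allS; apply: del_imp; first apply: del_and; first apply: del_and.
  + by apply: del_eq; exact: tf_size.
  + have t01 : tf (fun r => shift r 0 0) := tf_var 1.
    have t02 : tf (fun r => shift (shift r) 0 0) := tf_var 2.
    apply: del_allN; apply: del_imp; first by apply: del_lt => //; exact: tf_size.
    by apply: del_leq; exact: tf_nth.
  + exact: del_extends_nth.
  + have tK3 := tf_shift tK2.
    have t01 : tf (fun r => shift r 0 0) := tf_var 1.
    have t02 : tf (fun r => shift (shift r) 0 0) := tf_var 2.
    apply: del_exS; apply: del_and; first apply: del_and.
    * by apply: del_leq; exact: tf_size.
    * apply: del_allN; apply: del_imp; first by apply: del_lt => //; exact: tf_size.
      by apply: del_eq; exact: tf_nth.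
    * apply: del_pev_info => //; last exact: tf_const.
      by rewrite (_ : (fun r => _) = fun r => r 0 0) //; apply/funext => r; rewrite decodeK.
Qed.

Lemma info_prefix h w w' x y : prefix w w' -> info h w x y -> info h w' x y.
Proof.
move=> /prefixP[v ->] [ltx ->]; rewrite /info size_cat nth_cat ltx.
by split=> //; exact: ltn_addr.
Qed.

Lemma seen_prefix cT cb h w w' s : prefix w w' -> seen cT cb h w s -> seen cT cb h w' s.
Proof.
move=> pw [bs [[les bsP] H]]; exists bs; split.
  by split=> // j /bsP; apply: pev_mono => x y; exact: info_prefix.
move=> t /H[u [uP ue]]; exists u; split=> //.
by apply: pev_mono ue => x y; exact: info_prefix.
Qed.

Definition oracle (h : seq bool) (Y : nat -> bool) : nat -> nat :=
  fun n => nth false h n || Y n.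

Definition good_tree (cT cb : recfun) (O : nat -> nat) (T : set (seq nat)) : Prop :=
  exists b, [/\ is_tree T,
     forall s, eval_in O cT (string_code s) (`[< T s >] : nat),
     forall n, eval_in O cb n (b n) &
     forall s x, T s -> x < size s -> nth 0 s x <= b x].

Lemma prefix_mkseq (T : eqType) (f : nat -> T) m n : m <= n -> prefix (mkseq f m) (mkseq f n).
Proof. by move=> lemn; rewrite -(subnKC lemn) /mkseq iotaD map_cat prefix_prefix. Qed.

(** A path through the cylinder would, cut at the level of the evidence, be one of the strings [t];
    its rejected initial segment would nevertheless lie in the tree. *)
Lemma seen_sound cT cb h Y T k s : good_tree cT cb (oracle h Y) T ->
  seen cT cb h (mkseq Y k) s -> forall Z, paths T Z -> ~ extends Z s.
Proof.
move=> [b [treeT eT eb bT]] [bs [[les bsP] H]] Z ZT Zs.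
have infoY x y : info h (mkseq Y k) x y -> y = oracle h Y x.
  by rewrite /info size_mkseq => -[ltx ->]; rewrite nth_mkseq.
have [|u [[leu uP] ue]] := H (mkseq Z (size bs)).
  rewrite size_mkseq; split; first split=> // j ltj.
    rewrite (_ : nth 0 bs j = b j).
      by apply: bT; [exact: ZT | rewrite size_mkseq].
    exact: eval_in_fun (pev_eval infoY (bsP j ltj)) (eb j).
  by move=> j ltj; rewrite nth_mkseq ?Zs //; exact: leq_trans ltj les.
have : T u.
  apply: treeT (ZT (size bs)).
  rewrite (_ : u = mkseq Z (size u)).
    by apply: prefix_mkseq; move: leu; rewrite size_mkseq.
  apply: (@eq_from_nth _ 0); rewrite ?size_mkseq // => j ltj.
  rewrite uP // !nth_mkseq //.
  by apply: leq_trans ltj _; move: leu; rewrite size_mkseq.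
have := eval_in_fun (pev_eval infoY ue) (eT u).
by move=> e0 Tu; move: e0; rewrite asboolT.
Qed.

Lemma code_bounded (l : nat) (B : nat -> nat) : exists M, forall t,
  size t <= l -> (forall j, j < size t -> nth 0 t j <= B j) -> string_code t < M.
Proof.
elim: l B => [|l IHl] B; first by exists 1 => -[].
have [M MP] := IHl (fun j => B j.+1).
exists (pair_code (B 0) M).+2 => -[|x t] //=; rewrite ltnS => /MP{}MP tB.
rewrite ltnS; apply: leq_pair; first exact: (tB 0).
by apply: ltnW; apply: MP => j; exact: (tB j.+1).
Qed.

(** By Koenig's lemma the part of [T] compatible with [s] has bounded height. Above this height only
    finitely many computations are needed as evidence, so an initial segment of [Y] covers their
    uses. *)
Lemma seen_complete cT cb h Y T s : good_tree cT cb (oracle h Y) T ->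
  (forall Z, paths T Z -> ~ extends Z s) -> exists k, forall k', k <= k' -> seen cT cb h (mkseq Y k') s.
Proof.
move=> [b [treeT eT eb bT]] noZ.
pose T' := [set t | T t /\ forall j, j < size t -> j < size s -> nth 0 t j = nth 0 s j].
have [l lP] : exists l, forall t, T' t -> size t < l.
  apply: contrapT => /forallNP nl.
  have [|||Z ZT'] := @konig T' b.
  - move=> t t' ptt' [Tt' t'P]; split; first exact: treeT ptt' Tt'.
    move=> j ltj ltjs; rewrite -t'P //; last by apply: leq_trans ltj _; exact: size_prefix.
    by have /prefixP[v ->] := ptt'; rewrite nth_cat ltj.
  - by move=> t x [Tt _]; exact: bT.
  - move=> l; apply: contrapT => /forallNP H; apply: (nl l) => t T't.
    by rewrite ltnNge; apply/negP => let_; apply: (H t).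
  - apply: (noZ Z); first by move=> n; have [] := ZT' n.
    move=> j ltj; have [_ /(_ j)] := ZT' j.+1.
    by rewrite size_mkseq nth_mkseq //; exact.
(* At this level all strings compatible with [s] are outside [T], and the level is at least the
   length of [s], as [seen] requires. *)
pose L := maxn l (size s).
pose inf k := info h (mkseq Y k).
have mono k k' c n m : k <= k' -> pev (inf k) c n m -> pev (inf k') c n m.
  by move=> lek; apply: pev_mono => x y; apply: info_prefix; exact: prefix_mkseq.
have ev c n m : eval_in (oracle h Y) c n m -> exists k, pev (inf k) c n m.
  move=> /eval_pev[k kP]; exists k; apply: pev_mono kP => x y [ltx ->].
  by rewrite /inf /info size_mkseq nth_mkseq.
have [k1 k1P] : exists k, forall j, j < L -> pev (inf k) cb j (b j).
  by apply: bounded_choice => [j k k' /mono H|j _]; [exact: H | exact: ev].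
have [M MP] := code_bounded L b.
have [k2 k2P] : exists k, forall j, j < M -> ~ T (decode j) -> pev (inf k) cT j 0.
  apply: bounded_choice => [j k k' /mono H nT /nT|j _]; first exact: H.
  case: (pselect (T (decode j))) => [Tj|nT]; first by exists 0.
  have := eT (decode j); rewrite decodeK asboolF // => /ev[k kP].
  by exists k.
exists (maxn k1 k2) => k'; rewrite geq_max => /andP[lek1 lek2].
exists (mkseq b L); rewrite size_mkseq; split.
  split; first exact: leq_maxr.
  by move=> j ltj; rewrite nth_mkseq //; apply: mono lek1 _; exact: k1P.
move=> t [[st tb] ts].
exists t; split=> //; apply: mono lek2 _; apply: k2P.
  by apply: MP; rewrite ?st // => j ltj; have := tb j; rewrite st nth_mkseq //; exact.
rewrite string_codeK => Tt.
have : size t < l by apply: lP; split=> // j _; exact: ts.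
by rewrite st /L ltnNge leq_maxl.
Qed.


(** * An effective form of the open Ramsey theorem *)

Definition unbounded (X : nat -> bool) : Prop := forall n, exists m, n <= m /\ X m.
Definition included (Y X : nat -> bool) : Prop := forall n, Y n -> X n.
Definition supported (w : seq bool) (X : nat -> bool) : Prop := forall j, nth false w j -> X j.
(** Each finite set has exactly one aligned string, the one without trailing [false]; its length is
    one more than the maximum, or 0 for the empty set. *)
Definition aligned (w : seq bool) : Prop := forall j, size w = j.+1 -> nth false w j.

Definition ext (w : seq bool) (x : nat) : seq bool := rcons (w ++ nseq (x - size w) false) true.

Lemma size_ext w x : size w <= x -> size (ext w x) = x.+1.
Proof. by move=> lew; rewrite size_rcons size_cat size_nseq subnKC. Qed.

Lemma prefix_ext w x : prefix w (ext w x).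
Proof. by rewrite /ext rcons_cat prefix_prefix. Qed.

Lemma nth_ext w x j : size w <= x -> nth false (ext w x) j = nth false w j || (j == x).
Proof.
move=> lew; rewrite nth_rcons nth_cat nth_nseq size_cat size_nseq subnKC //.
case: (ltngtP j x) => [ltj|ltj|->].
- case: ltnP => ltjw; rewrite ?orbF // [in RHS]nth_default //; by case: ifP.
- by rewrite nth_default // ltnW // (leq_ltn_trans lew).
- by rewrite orbT.
Qed.

Lemma aligned_ext w x : size w <= x -> aligned (ext w x).
Proof. by move=> lew j; rewrite size_ext // => -[<-]; rewrite nth_ext // eqxx orbT. Qed.

Lemma supported_ext w x X : size w <= x -> supported w X -> X x -> supported (ext w x) X.
Proof. by move=> lew wX Xx j; rewrite nth_ext // => /orP[/wX|/eqP->]. Qed.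

(** Induction on finite sets by removal of the maximum. What remains may end in [false] entries,
    which are stripped to reach an aligned string again. *)
Lemma aligned_ind (P : seq bool -> Prop) :
  P [::] -> (forall w x, aligned w -> size w <= x -> P w -> P (ext w x)) ->
  forall w, aligned w -> P w.
Proof.
move=> P0 PS w; have [n] := ubnP (size w); elim: n w => // n IHn w.
case: (posnP (size w)) => [/size0nil-> //|].
case: (lastP w) => // v b _; rewrite size_rcons ltnS => ltv alw.
have -> : b = true by have := alw (size v); rewrite size_rcons nth_rcons ltnn eqxx => ->.
have [u alu [leu ->]] : exists2 u, aligned u &
    size u <= size v /\ v = u ++ nseq (size v - size u) false.
  elim/last_ind: v {ltv alw} => [|v c [u alu [leu eqv]]].
    by exists [::] => //; split.
  case: c.
    exists (rcons v true) => [j|]; last by rewrite subnn cats0.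
    by rewrite size_rcons => -[<-]; rewrite nth_rcons ltnn eqxx.
  exists u => //; rewrite size_rcons; split; first exact: leqW.
  by rewrite {1}eqv subSn // -cats1 -catA -addn1 nseqD.
rewrite -/(ext u (size v)); apply: PS => //.
by apply: IHn => //; exact: leq_ltn_trans leu ltv.
Qed.

Section Ultrafilter.
Variables (U : set_system nat) (UF : UltraFilter U).

Lemma ultra_bounded m (A : seq bool -> set nat) :
  (forall w, U (A w)) -> U [set x | forall w, size w <= m -> A w x].
Proof.
elim: m A => [|m IHm] A UA.
  by apply: filterS (UA [::]) => x Ax w; rewrite leqn0 => /eqP/size0nil->.
apply: filterS (filterI (UA [::]) (filterI (IHm _ (fun w => UA (true :: w)))
  (IHm _ (fun w => UA (false :: w))))) => x [Ax [At Af]] [|[] w] //; [exact: At | exact: Af].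
Qed.

(** A diagonal intersection: each new element is chosen in [A w] for all of the finitely many [w]
    whose length is at most the successor of the previous element. *)
Lemma ultra_fusion (X : nat -> bool) (A : seq bool -> set nat) :
  U X -> (forall m, U [set x | m <= x]) -> (forall w, U (A w)) ->
  exists X', [/\ included X' X, unbounded X' &
    forall w, aligned w -> supported w X' -> forall x, size w <= x -> X' x -> A w x].
Proof.
move=> UX Ucof UA.
have /choice[f fP] m : exists x, [/\ X x, m <= x & forall w, size w <= m -> A w x].
  have [x [Xx [lex Ax]]] := filter_ex (filterI UX (filterI (Ucof m) (ultra_bounded m UA))).
  by exists x.
pose fix y n := if n is m.+1 then f (y m).+1 else f 0.
have ltyS n : y n < y n.+1 by have [_ ] := fP (y n).+1.
have lty m n : m < n -> y m < y n.
  elim: n => // n IHn; rewrite ltnS leq_eqVlt => /predU1P[->|/IHn H]; first exact: ltyS.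
  exact: ltn_trans H (ltyS n).
have ley n : n <= y n by elim: n => // n IHn; exact: leq_ltn_trans IHn (ltyS n).
exists (fun x => `[< exists n, x = y n >]); split.
- by move=> x /asboolP[[|n] ->] /=; [have [] := fP 0 | have [] := fP (y n).+1].
- by move=> n; exists (y n); split=> //; apply/asboolP; exists n.
- move=> w alw wX x lew /asboolP[n en].
  case E: (size w) lew => [|j] lew.
    by rewrite en; case: n {en} => [|n] /=; [have [_ _] := fP 0 | have [_ _] := fP (y n).+1];
      apply; rewrite E.
  have /wX/asboolP[k ek] := alw j E.
  case: n en => [|n] en; move: lew; rewrite en ek => /=.
    by case: k {ek} => [|k] ; [rewrite ltnn | rewrite ltnNge ltnW // (lty 0)].
  move=> ltkn; have lekn : k <= n.
    by rewrite leqNgt; apply/negP => ltnk; move: ltkn; rewrite ltnNge -/(y n.+1);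
      case: (ltngtP n.+1 k) ltnk => // [/lty/ltnW-> //|-> _]; rewrite leqnn.
  have [_ _ fA] := fP (y n).+1; apply: fA; rewrite E ek ltnS.
  by move: lekn; rewrite leq_eqVlt => /predU1P[->//|/lty/ltnW].
Qed.
End Ultrafilter.

Definition bsub (u' u : seq bool) : Prop := forall j, nth false u' j -> nth false u j.

(* [O] is decided on the first element of an aligned set that completes a member of
   [O]: this turns the open partition into a clopen one. *)
Definition first_in (O : seq bool -> Prop) (u : seq bool) : Prop :=
  O u /\ forall u', aligned u' -> size u' < size u -> bsub u' u -> ~ O u'.

(** The ultrafilter form of acceptance in the style of Nash-Williams: a well-founded tree above [u],
    branching over sets of [U], whose leaves satisfy [first_in O]. *)
Inductive accepted (O : seq bool -> Prop) (U : set_system nat) : seq bool -> Prop :=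
| Accept u : first_in O u -> accepted O U u
| AcceptLim u A : U A -> (forall x, A x -> size u <= x -> accepted O U (ext u x)) -> accepted O U u.

Lemma accepted_ext O U u : UltraFilter U -> (forall m, U [set x | m <= x]) ->
  accepted O U u -> exists v, prefix u v /\ first_in O v.
Proof.
move=> UU Ucof; elim=> {}u; first by exists u; rewrite prefix_refl.
move=> A UA _ IH; have [x [Ax lex]] := filter_ex (filterI UA (Ucof (size u))).
have [v [pv Ov]] := IH x Ax lex; exists v; split=> //.
exact: prefix_trans (prefix_ext u x) pv.
Qed.

(** After thinning by an ultrafilter, the empty set is accepted, for otherwise no finite subset of
    [X'] would be, against [hitO]. Hence each finite subset [u] either extends a member of
    [first_in O], or is accepted and has an extension [v] in [first_in O]. In the latter case [u']
    contradicts the minimality of [v] unless [v] is [u]. *)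
Lemma open_ramsey (O : seq bool -> Prop) (X : nat -> bool) : unbounded X ->
  (forall w w', prefix w w' -> O w -> O w') ->
  (forall X', included X' X -> unbounded X' -> exists w, supported w X' /\ O w) ->
  exists X', [/\ included X' X, unbounded X' &
    forall u' u, aligned u' -> size u' = size u -> bsub u' u -> supported u X' -> O u' -> O u].
Proof.
move=> infX monoO hitO.
(* The sets that contain a tail of [X] form the filter to be refined. *)
have FF : ProperFilter [set A : set nat | exists m, forall x, m <= x -> X x -> A x].
  split; first by move=> [m mP]; have [x [lex Xx]] := infX m; exact: (mP x).
  split; first by exists 0.
    move=> A B [m mP] [n nP]; exists (maxn m n) => x; rewrite geq_max => /andP[lem len] Xx.
    by split; [exact: mP | exact: nP].
  by move=> A B AB [m mP]; exists m => x lex Xx; apply: AB; exact: mP.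
have [U [UU FU]] := ultraFilterLemma FF.
have UX : U X by apply: FU; exists 0.
have Ucof m : U [set x | m <= x] by apply: FU; exists m.
pose G := accepted O U.
(* Rejection has to pass to extensions by one element, and so does acceptance as long as
   [first_in O] is not yet reached. *)
pose A w := [set x | size w <= x ->
  (~ G w -> ~ G (ext w x)) /\ (G w -> ~ first_in O w -> G (ext w x))].
have UA w : U (A w).
  case: (pselect (G w)) => Gw.
    case: (pselect (first_in O w)) => Ow; first by apply: filterS filterT => x _ _; split.
    case: Gw Ow => [u Ou nOu|u B UB BG _]; first by case: (nOu Ou).
    apply: filterS (UB) => x Bx lex; split=> [nG|_ _]; last exact: BG.
    by case: nG; exact: AcceptLim UB BG.
  have [UG|UG] := in_ultra_setVsetC [set x | size w <= x -> G (ext w x)] UU.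
    by case: Gw; exact: AcceptLim UG _.
  apply: filterS UG => x nGx lex; split=> // _ Gx.
  by apply: nGx => _.
have [X' [subX' infX' X'A]] := ultra_fusion UU UX Ucof UA.
exists X'; split=> //.
have aln u x : supported (ext u x) X' -> size u <= x -> supported u X' /\ X' x.
  move=> uX lex; split=> [j uj|]; apply: uX; rewrite nth_ext ?uj // eqxx orbT //.
have [G0|nG0] := pselect (G [::]); last first.
  have nG u : aligned u -> supported u X' -> ~ G u.
    move=> alu; elim/aligned_ind: u / alu => // w x alw lex IH wX.
    have [wX' Xx] := aln _ _ wX lex.
    by have [H _] := X'A w alw wX' x lex Xx lex; apply: H; exact: IH.
  exfalso; have [w [wX Ow]] := hitO X' subX' infX'.
  have [x [lex Xx]] := infX' (size w).
  have := @aligned_ext w x lex; have := supported_ext lex wX Xx.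
  have : O (ext w x) by apply: monoO Ow; exact: prefix_ext.
  (* Strong induction on the length reaches a shortest aligned member of [O]; it satisfies
     [first_in O] and is therefore accepted, although nothing is. *)
  move: (ext w x) => u {w wX Ow x lex Xx}; have [n] := ubnP (size u).
  elim: n u => // n IHn u; rewrite ltnS => leu Ou uX alu.
  apply: (nG u alu uX); apply: Accept; split=> // u' alu' ltu' subu Ou'.
  by apply: (IHn u') => //; [exact: leq_trans ltu' leu | move=> j /subu /uX].
have GO u : aligned u -> supported u X' -> G u \/ exists v, prefix v u /\ first_in O v.
  move=> alu; elim/aligned_ind: u / alu; first by left.
  move=> w x alw lex IH wX; have [wX' Xx] := aln _ _ wX lex.
  have [Gw|[v [pv Ov]]] := IH wX'; last first.
    by right; exists v; split=> //; exact: prefix_trans pv (prefix_ext w x).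
  case: (pselect (first_in O w)) => Ow.
    by right; exists w; split=> //; exact: prefix_ext.
  by left; have [_ H] := X'A w alw wX' x lex Xx lex; exact: H.
move=> u' u alu' eqs subu uX Ou'.
have alu : aligned u by move=> j; rewrite -eqs => /alu' /subu.
have [Gu|[v [pv [Ov _]]]] := GO u alu uX; last exact: monoO Ov.
have [v [/prefixP[s ev] [Ov Fv]]] := accepted_ext UU Ucof Gu.
case: s ev => [|b s] ev; first by move: Ov; rewrite ev cats0.
case: (Fv u' alu') => //; first by rewrite eqs ev size_cat /= addnS ltnS leq_addr.
move=> j /subu uj; rewrite ev nth_cat; case: ltnP => // lej.
by move: uj; rewrite nth_default.
Qed.


(** * A basis theorem *)

(** Every real is read as the set of places where it is non-zero, so that a quantifier over sets
    becomes a quantifier over reals. *)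
Definition bit (R : nat -> nat) : nat -> nat := fun n => R n != 0.
Definition chi (X : nat -> bool) : nat -> nat := fun n => X n.

Lemma bit_chi X : bit (chi X) = chi X.
Proof. by apply/funext => n; rewrite /bit /chi; case: (X n). Qed.

Definition no_sig_subset (C : set baire) (X : nat -> bool) : Prop :=
  forall A, sigma11 A -> (exists Z, A (Z .: chi X .: zenv)) ->
    exists Z, A (Z .: chi X .: zenv) /\ ~ C Z.

Definition seq_closed (C : set baire) : Prop :=
  forall Z : baire, ~ C Z -> exists n, forall Z' : baire, (forall j, j < n -> Z' j = Z j) -> ~ C Z'.

(** Since each Sigma-1-1 relation has this form, an enumeration of terms lists all requirements that
    a lean set has to meet. *)
Definition ntm_sig (t : tm) : env -> Prop :=
  fun r => exists Y, forall n, teval t (Y .: cst n .: r) = 0.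

Lemma sig_ntm A : sigma11 A -> exists t, A = ntm_sig t.
Proof.
move=> [F [t /funext eF] FP]; exists t; apply/funext => r; apply/propext.
by rewrite FP eF.
Qed.

Lemma sig_of_ntm t : sigma11 (ntm_sig t).
Proof. by exists (teval t) => //; exists t. Qed.

(** * Enumerations of codes and terms *)

Fixpoint tree_of_recfun (c : recfun) : GenTree.tree nat :=
  match c with
  | RZero => GenTree.Leaf 0 | RSucc => GenTree.Leaf 1 | RFst => GenTree.Leaf 2
  | RSnd => GenTree.Leaf 3 | ROracle => GenTree.Leaf 4
  | RPair c d => GenTree.Node 0 [:: tree_of_recfun c; tree_of_recfun d]
  | RComp c d => GenTree.Node 1 [:: tree_of_recfun c; tree_of_recfun d]
  | RPrec c d => GenTree.Node 2 [:: tree_of_recfun c; tree_of_recfun d]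
  | RMu c => GenTree.Node 3 [:: tree_of_recfun c]
  end.

Fixpoint recfun_of_tree (t : GenTree.tree nat) : recfun :=
  match t with
  | GenTree.Leaf 0 => RZero | GenTree.Leaf 1 => RSucc | GenTree.Leaf 2 => RFst
  | GenTree.Leaf 3 => RSnd
  | GenTree.Node 0 [:: c; d] => RPair (recfun_of_tree c) (recfun_of_tree d)
  | GenTree.Node 1 [:: c; d] => RComp (recfun_of_tree c) (recfun_of_tree d)
  | GenTree.Node 2 [:: c; d] => RPrec (recfun_of_tree c) (recfun_of_tree d)
  | GenTree.Node 3 [:: c] => RMu (recfun_of_tree c)
  | _ => ROracle
  end.

Lemma tree_of_recfunK : cancel tree_of_recfun recfun_of_tree.
Proof. by elim=> //= [c -> d ->|c -> d ->|c -> d ->|c ->]. Qed.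

Fixpoint tree_of_tm (t : tm) : GenTree.tree (nat + GenTree.tree nat) :=
  match t with
  | TLook i t => GenTree.Node 0 [:: GenTree.Leaf (inl i); tree_of_tm t]
  | TApp c t => GenTree.Node 1 [:: GenTree.Leaf (inr (tree_of_recfun c)); tree_of_tm t]
  | TPair s t => GenTree.Node 2 [:: tree_of_tm s; tree_of_tm t]
  | TZero => GenTree.Node 3 [::]
  end.

Fixpoint tm_of_tree (t : GenTree.tree (nat + GenTree.tree nat)) : tm :=
  match t with
  | GenTree.Node 0 [:: GenTree.Leaf (inl i); t] => TLook i (tm_of_tree t)
  | GenTree.Node 1 [:: GenTree.Leaf (inr c); t] => TApp (recfun_of_tree c) (tm_of_tree t)
  | GenTree.Node 2 [:: s; t] => TPair (tm_of_tree s) (tm_of_tree t)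
  | _ => TZero
  end.

Lemma tree_of_tmK : cancel tree_of_tm tm_of_tree.
Proof. by elim=> //= [i t ->|c t ->|s -> t ->]; rewrite ?tree_of_recfunK. Qed.

Lemma enum_countable (T : countType) (S : Type) (f : S -> T) (g : T -> S) :
  cancel f g -> S -> exists e : nat -> S, forall s, exists n, e n = s.
Proof.
move=> fK s0; exists (fun n => if unpickle n is Some x then g x else s0) => s.
by exists (pickle (f s)); rewrite pickleK fK.
Qed.

Lemma enum_tm : exists e : nat -> tm, forall t, exists n, e n = t.
Proof. exact: (enum_countable tree_of_tmK TZero). Qed.

Lemma enum_recfun2 : exists e : nat -> recfun * recfun, forall t, exists n, e n = t.
Proof.
apply: (@enum_countable _ _ (fun p => (tree_of_recfun p.1, tree_of_recfun p.2))
  (fun p => (recfun_of_tree p.1, recfun_of_tree p.2)) _ (RZero, RZero)).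
by case=> c d /=; rewrite !tree_of_recfunK.
Qed.

Definition depends_below (e : nat) (K : env -> Prop) : Prop :=
  forall W W', (forall i, i < e -> W i = W' i) -> K W -> K W'.

Definition env_closed (K : env -> Prop) : Prop :=
  forall W, (forall N, exists W', K W' /\ forall i j, i < N -> j < N -> W' i j = W i j) -> K W.

Section Basis.
Variables (C : set baire) (X : nat -> bool).

Definition sig_env (K : env -> Prop) : Prop :=
  exists2 A, sigma11 A & forall w, A (w .: chi X .: zenv) <-> K (column w).

(** Gandy forcing with explicit witnesses. Column 0 is the generic real and the other columns below
    [e] witness the existential statements promised so far. Recording them makes [K] closed, and the
    columns from [e] on are free for new witnesses. *)
Definition condition (e : nat) (K : env -> Prop) : Prop :=
  [/\ depends_below e K, env_closed K, sig_env K & exists W, K W].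

Definition met (t : tm) (K : env -> Prop) : Prop :=
  (forall W, K W -> exists Z, ntm_sig t (Z .: bit (W 0) .: zenv) /\ ~ C Z) \/
  (forall W Z, K W -> ~ ntm_sig t (Z .: bit (W 0) .: zenv)).

Lemma column_surj (W : env) : exists w, column w = W.
Proof. by exists (columns W); apply/funext => i; rewrite columnK. Qed.

(** Let [D] collect the points that the class of [t] contains relative to column 0 of some member of
    [K]. If [D] is empty, [K] already meets the requirement. Otherwise leanness of [X] gives [Z] in
    [D] outside [C], and [C] misses a cylinder around [Z]; the new condition asks, with a witness in
    column [e], for a point of the class in this cylinder. *)
Lemma condition_met e K t : seq_closed C -> no_sig_subset C X -> 0 < e -> condition e K ->
  exists K', [/\ forall W, K' W -> K W, condition e.+1 K' & met t K'].
Proof.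
move=> clC noX e_gt0 [depK clK [A sA AK] [W0 KW0]].
have depK' : depends_below e.+1 K.
  by move=> W W' eqW; apply: depK => i /ltnW; exact: eqW.
pose D r := exists w, A (w .: r 1 .: zenv) /\ ntm_sig t (r 0 .: bit (column w 0) .: zenv).
have sD : sigma11 D.
  apply: sig_exR; apply: sig_and.
    apply: (@sig_sub A (fun r => r 0 .: shift r 1 .: zenv)) => // -[|[|i]] /=.
    - exact: (tf_look 1 (tf_var 0)).
    - exact: (tf_look 3 (tf_var 0)).
    - exact: tf_const.
  apply: (@sig_sub (ntm_sig t) (fun r => shift r 0 .: bit (column (r 0) 0) .: zenv)) =>
    [|[|[|i]]] /=.
  - exact: sig_of_ntm.
  - exact: (tf_look 2 (tf_var 0)).
  - apply: (@tf_neg (fun r => column (shift r 0) 0 (r 0 0) == 0)); apply: tf_eq;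
    last exact: tf_const.
    exact: (tf_column 1 0 (tf_var 0)).
  - exact: tf_const.
case: (pselect (exists Z, D (Z .: chi X .: zenv))) => [/(noX _ sD)|noD]; last first.
  exists K; split=> //; first by split=> //; [exists A | exists W0].
  right=> W Z KW tZ; apply: noD; have [w ew] := column_surj W.
  by exists Z, w; rewrite /= ew; split=> //; apply/AK; rewrite ew.
move=> [Z [[w [/AK Kw tZ]] nCZ]]; have [n nP] := clC Z nCZ.
pose B r := exists Z', (forall j, j < n -> Z' j = nth 0 (decode (string_code (mkseq Z n))) j) /\
  ntm_sig t (Z' .: bit (r 0) .: zenv).
have [F tF FP] : sigma11 B.
  apply: sig_exR; apply: sig_and.
    apply: (proj1 (A := sigma11 _)); apply: del_allN; apply: del_imp.
      by apply: del_lt; [exact: tf_var | exact: tf_const].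
    apply: del_eq; first exact: (tf_look 1 (tf_var 0)).
    by apply: (@tf_nth (fun=> _)); [exact: tf_const | exact: tf_var].
  apply: (@sig_sub (ntm_sig t) (fun r => r 0 .: bit (shift r 0) .: zenv)) => [|[|[|i]]] /=.
  - exact: sig_of_ntm.
  - exact: (tf_look 1 (tf_var 0)).
  - apply: (@tf_neg (fun r => shift (shift r) 0 (r 0 0) == 0)); apply: tf_eq; last exact: tf_const.
    exact: (tf_look 2 (tf_var 0)).
  - exact: tf_const.
have BP W : B (W .: zenv) -> exists Z', ntm_sig t (Z' .: bit W .: zenv) /\ ~ C Z'.
  move=> [Z' [Z'Z tZ']]; exists Z'; split=> //; apply: nP => j ltj.
  by rewrite Z'Z // string_codeK nth_mkseq.
pose K' W := K W /\ forall m, F (W e .: cst m .: W 0 .: zenv) = 0.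
exists K'; split; first by move=> W [].
  split.
  - move=> W W' eqW [/(depK' _ _ eqW) KW FW]; split=> // m.
    by rewrite -!eqW.
  - move=> W WP; split; first by apply: clK => N; have [W' [[KW' _] H]] := WP N; exists W'.
    move=> m; have [N NP] := tf_cont tF (W e .: cst m .: W 0 .: zenv).
    have [W' [[_ FW'] eqW]] := WP (N + e.+1).
    rewrite -(NP (W' e .: cst m .: W' 0 .: zenv)) // => -[|[|[|i]]] j lti ltj //=; apply: eqW; lia.
  - exists (fun r => A r /\ forall m, F (column (r 0) e .: cst m .: column (r 0) 0 .: zenv) = 0).
      apply: sig_and => //; apply: sig_allN; apply: sig_tf.
      apply: (@tf_sub F (fun r => column (shift r 0) e .: cst (r 0 0) .: column (shift r 0) 0 .: zenv)) => // -[|[|[|i]]] /=.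
      + exact: (tf_column 2 e (tf_var 0)).
      + exact: (tf_var 1).
      + exact: (tf_column 2 0 (tf_var 0)).
      + exact: tf_const.
    by move=> w'; rewrite /K' AK.
  - have /FP[Y YP] : B (column w 0 .: zenv).
      exists Z; split=> // j ltj; by rewrite string_codeK nth_mkseq.
    (* [K] does not constrain column [e], and column 0 is kept because [e] is positive. *)
    exists (fun i => if i == e then Y else column w i); split.
      apply: depK Kw => i lti; by rewrite ltn_eqF.
    by move=> m; rewrite eqxx ltn_eqF.
left=> W [KW FW]; apply: BP; apply/FP; by exists (W e).
Qed.

(** Deciding the values one by one makes the conditions shrink to a single sequence of reals. *)
Lemma condition_decide e K a b : condition e K -> a < e ->
  exists K', [/\ forall W, K' W -> K W, condition e K' &
    forall W W', K' W -> K' W' -> W a b = W' a b].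
Proof.
move=> [depK clK [A sA AK] [W0 KW0]] lta.
exists (fun W => K W /\ W a b = W0 a b); split; first by move=> W [].
  split.
  - move=> W W' eqW [/(depK _ _ eqW) KW eW]; split=> //.
    by rewrite -eqW.
  - move=> W WP; split; first by apply: clK => N; have [W' [[KW' _] H]] := WP N; exists W'.
    have [W' [[_ <-] eqW]] := WP (a + b).+1.
    by rewrite eqW //; lia.
  - exists (fun r => A r /\ column (r 0) a b = W0 a b).
      apply: sig_and => //; apply: (proj1 (A := sigma11 _)); apply: del_eq; last exact: tf_const.
      by apply: tf_column; exact: tf_const.
    by move=> w; rewrite AK.
  - by exists W0.
by move=> W W' [_ ->] [_ ->].
Qed.

(** A decreasing sequence of conditions is built, stage [e] meeting the requirement of the [e]-th
    term and deciding the coordinate coded by [e]. The limit lies in all conditions because they are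
    closed, and its column 0 is the required set. *)
Lemma sig_basis A : seq_closed C -> no_sig_subset C X -> sigma11 A ->
  (exists X', A (chi X' .: chi X .: zenv)) ->
  exists X', A (chi X' .: chi X .: zenv) /\ no_sig_subset C X'.
Proof.
move=> clC noX sA [X0 AX0].
have [enum enumP] := enum_tm.
have [F tF FP] : sigma11 (fun r => A (bit (r 0) .: shift r)).
  apply: sig_sub => // -[|i] /=; last exact: (tf_look i.+2 (tf_var 0)).
  apply: (@tf_neg (fun r => shift r 0 (r 0 0) == 0)); apply: tf_eq; last exact: tf_const.
  exact: (tf_look 1 (tf_var 0)).
(* Column 1 witnesses that the set given by column 0 is in the class, so the stages start with two
   columns in use. *)
pose K0 (W : env) := forall n, F (W 1 .: cst n .: W 0 .: chi X .: zenv) = 0.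
have cond0 : condition 2 K0.
  split.
  - by move=> W W' eqW KW n; rewrite -!eqW.
  - move=> W WP n; have [N NP] := tf_cont tF (W 1 .: cst n .: W 0 .: chi X .: zenv).
    have [W' [KW' eqW]] := WP N.+2.
    rewrite -(NP (W' 1 .: cst n .: W' 0 .: chi X .: zenv)) // => -[|[|[|i]]] j lti ltj //=;
      apply: eqW; lia.
  - exists (fun r => forall n, F (column (r 0) 1 .: cst n .: column (r 0) 0 .: shift r) = 0) => //.
    apply: sig_allN; apply: sig_tf.
    apply: (@tf_sub F (fun r => column (shift r 0) 1 .: cst (r 0 0) .: column (shift r 0) 0 .: shift (shift r))) => // -[|[|[|i]]] /=.
    + exact: (tf_column 2 1 (tf_var 0)).
    + exact: (tf_var 1).
    + exact: (tf_column 2 0 (tf_var 0)).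
    + exact: (tf_look i.+3 (tf_var 0)).
  - have /(FP (chi X0 .: chi X .: zenv))[Y YP] : A (bit (chi X0) .: chi X .: zenv) by rewrite bit_chi.
    by exists (fun i => if i is 0 then chi X0 else Y).
have /choice[nxt nxtP] p : exists K', condition p.1.+2 p.2 ->
    [/\ forall W, K' W -> p.2 W, condition p.1.+3 K', met (enum p.1) K' &
      forall W W', K' W -> K' W' -> W (pfst p.1) (psnd p.1) = W' (pfst p.1) (psnd p.1)].
  case: p => e K /=; case: (pselect (condition e.+2 K)) => [cK|]; last by exists K.
  have [K1 [K1K cK1 mK1]] := condition_met (enum e) clC noX (ltn0Sn _) cK.
  (* The column [pfst e] is at most [e], hence among those that a condition of index [e.+3] may
     constrain. *)
  have [|K2 [K2K1 cK2 dK2]] := @condition_decide _ _ (pfst e) (psnd e) cK1.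
    by have := leq_pfst e; lia.
  exists K2 => _; split=> //; first by move=> W /K2K1/K1K.
  case: mK1 => mK1; [left=> W /K2K1; exact: mK1 | right=> W Z /K2K1; exact: mK1].
pose fix Ks e := if e is e'.+1 then nxt (e', Ks e') else K0.
have condKs e : condition e.+2 (Ks e) by elim: e => //= e IHe; have [] := nxtP (e, Ks e) IHe.
have sub1 e W : Ks e.+1 W -> Ks e W by have [H _ _ _] := nxtP (e, Ks e) (condKs e); exact: H.
have sub e e' W : e <= e' -> Ks e' W -> Ks e W.
  by move=> /subnKC <-; elim: (e' - e) => [|k IHk]; rewrite ?addn0 // addnS => /sub1.
have dec e W W' : Ks e.+1 W -> Ks e.+1 W' -> W (pfst e) (psnd e) = W' (pfst e) (psnd e).
  by have [_ _ _ H] := nxtP (e, Ks e) (condKs e); exact: H.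
have mt e : met (enum e) (Ks e.+1) by have [] := nxtP (e, Ks e) (condKs e).
have /choice[w wP] e : exists W, Ks e W by have [] := condKs e.
(* All members of the conditions after stage [pair_code a b] agree at this coordinate. *)
pose W a b := w (pair_code a b).+1 a b.
have WP a b e : pair_code a b < e -> w e a b = W a b.
  move=> lte; have := @dec (pair_code a b) (w e) (w (pair_code a b).+1).
  by rewrite pfst_pair psnd_pair; apply=> //; exact: sub lte _.
have KW e : Ks e W.
  have [_ cl _ _] := condKs e; apply: cl => N.
  exists (w (e + (pair_code N N).+1)); split; first by apply: sub (wP _); exact: leq_addr.
  move=> i j lti ltj; apply: WP.
  by have := leq_pair (ltnW lti) (ltnW ltj); lia.
exists (fun n => W 0 n != 0); split.
  apply/(FP (W 0 .: chi X .: zenv)); exists (W 1); exact: (KW 0).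
move=> B /sig_ntm[t ->] [Z BZ]; have [e et] := enumP t.
case: (mt e) => [/(_ W (KW e.+1))|/(_ W Z (KW e.+1))]; rewrite et //.
Qed.

End Basis.


(** * Reservoirs without good subsets *)

Definition good (C : set baire) (cT cb : recfun) (O : nat -> nat) : Prop :=
  exists T, [/\ good_tree cT cb O T, exists Z, paths T Z & forall Z, paths T Z -> C Z].

(** The string [h] stands for the finite part of the set that is fixed before the reservoir [X] is
    used. *)
Definition bad (C : set baire) (cT cb : recfun) (h : seq bool) (X : nat -> bool) : Prop :=
  forall Y, included Y X -> unbounded Y -> ~ good C cT cb (oracle h Y).

Definition avoids (cT cb : recfun) (h : seq bool) (X : nat -> bool) (s : seq nat) : Prop :=
  forall w, supported w X -> ~ seen cT cb h w s.

Lemma included_trans Y X X' : included X X' -> included Y X -> included Y X'.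
Proof. by move=> XX' YX n /YX/XX'. Qed.

Lemma bad_included C cT cb h X X' : included X' X -> bad C cT cb h X -> bad C cT cb h X'.
Proof. by move=> subX' badX Y subY; apply: badX; exact: included_trans subY. Qed.

Lemma supported_mkseq Y k : supported (mkseq Y k) Y.
Proof.
move=> j; case: (ltnP j k) => [ltj|lej]; first by rewrite nth_mkseq.
by rewrite nth_default ?size_mkseq.
Qed.

Lemma supported_included w X X' : included X X' -> supported w X -> supported w X'.
Proof. by move=> XX' wX j /wX/XX'. Qed.

(** If no path met the cylinder of [s], a finite part of [Y] would be evidence of it, by
    completeness of [seen]. *)
Lemma avoids_path C cT cb h X Y s : included Y X -> avoids cT cb h X s ->
  good C cT cb (oracle h Y) -> exists Z, C Z /\ extends Z s.
Proof.
move=> subY avX [T [gT _ TC]]; apply: contrapT => noZ.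
have [|k kP] := seen_complete gT (s := s).
  by move=> Z ZT Zs; apply: noZ; exists Z; split=> //; exact: TC.
apply: (avX (mkseq Y k)); last exact: kP.
exact: supported_included subY (@supported_mkseq _ _).
Qed.

(** A pseudo-intersection, obtained by taking the [n]-th element in the [n]-th set. *)
Lemma fusion_sequence (Xs : nat -> nat -> bool) : (forall n, unbounded (Xs n)) ->
  (forall n, included (Xs n.+1) (Xs n)) ->
  exists X, [/\ included X (Xs 0), unbounded X &
    forall n, exists k, forall x, X x -> k <= x -> Xs n x].
Proof.
move=> infX decX.
have dec m n : m <= n -> included (Xs n) (Xs m).
  by move=> /subnKC <-; elim: (n - m) => [|k IHk] x; rewrite ?addn0 // addnS => /decX/IHk.
have /choice[f fP] p : exists x, p.1 <= x /\ Xs p.2 x by exact: infX.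
pose fix y n := if n is m.+1 then f ((y m).+1, m.+1) else f (0, 0).
have yX n : Xs n (y n) by case: n => [|n]; [have [] := fP (0, 0) | have [] := fP ((y n).+1, n.+1)].
have lty n : y n < y n.+1 by have [] := fP ((y n).+1, n.+1).
have ley n : n <= y n by elim: n => // n IHn; exact: leq_ltn_trans IHn (lty n).
have ley2 m n : m <= n -> y m <= y n.
  by move=> /subnKC <-; elim: (n - m) => [|k IHk]; rewrite ?addn0 // addnS;
    exact: leq_trans IHk (ltnW (lty _)).
exists (fun x => `[< exists n, x = y n >]); split.
- by move=> x /asboolP[n ->]; exact: dec (leq0n n) _ (yX n).
- by move=> n; exists (y n); split=> //; apply/asboolP; exists n.
- move=> n; exists (y n) => x /asboolP[m ->] lenm.
  case: (leqP n m) => [len|ltm]; first exact: dec len _ (yX m).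
  by move: (leq_trans (leq_trans (lty m) (ley2 _ _ ltm)) lenm); rewrite ltnn.
Qed.

Section Step.
Variables (C : set baire) (bound : nat -> nat) (cT cb : recfun) (h : seq bool).
Hypothesis clC : seq_closed C.
Hypothesis boundC : forall Z n, C Z -> Z n <= bound n.

Local Notation seen := (seen cT cb h).
Local Notation avoids := (avoids cT cb h).
Local Notation bad := (bad C cT cb h).
Local Notation nosub := (no_sig_subset C).

Definition real_set (R : nat -> nat) : nat -> bool := fun n => R n != 0.

Lemma real_set_chi X : real_set (chi X) = X.
Proof. by apply/funext => n; rewrite /real_set /chi; case: (X n). Qed.

Lemma del_mem i F : tf F -> delta11 (fun r => real_set (r i) (F r)).
Proof.
move=> tF; apply: del_bool; apply: (@tf_neg (fun r => r i (F r) == 0)).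
by apply: tf_eq; [exact: tf_look | exact: tf_const].
Qed.

Lemma del_mem_shift i F : tf F -> delta11 (fun r => real_set (shift r i) (F r)).
Proof. exact: (@del_mem i.+1). Qed.

Lemma del_included i j : delta11 (fun r => included (real_set (r i)) (real_set (r j))).
Proof. by apply: del_allN; apply: del_imp; apply: del_mem_shift; exact: tf_var. Qed.

Lemma del_unbounded i : delta11 (fun r => unbounded (real_set (r i))).
Proof.
apply: del_allN; apply: del_exN; apply: del_and; last exact: (@del_mem i.+2 _ (tf_var 0)).
by apply: del_leq; [exact: (tf_var 1) | exact: tf_var].
Qed.

Lemma tf_nth_bits K F : tf K -> tf F -> tf (fun r => nth false (bits (decode (K r))) (F r)).
Proof.
move=> tK tF; rewrite (_ : (fun r => _) = fun r => ~~ (nth 0 (decode (K r)) (F r) == 0) : nat).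
  by apply: (@tf_neg (fun r => nth 0 (decode (K r)) (F r) == 0)); apply: tf_eq;
    [exact: tf_nth | exact: tf_const].
by apply/funext => r; rewrite nth_bits.
Qed.

Lemma del_supported K i : tf K -> delta11 (fun r =>
  supported (bits (decode (K r))) (real_set (r i))).
Proof.
move=> tK; apply: del_allN; apply: del_imp; last exact: (@del_mem i.+1 _ (tf_var 0)).
by apply: del_bool; apply: tf_nth_bits; [exact: (tf_shift tK) | exact: tf_var].
Qed.

Lemma del_seen_const K s : tf K -> delta11 (fun r => seen (bits (decode (K r))) s).
Proof.
move=> tK; rewrite -(string_codeK s).
exact: (@del_seen cT cb h K (fun=> string_code s) tK (tf_const _)).
Qed.

(** Avoidance is arithmetical in the reservoir, so the basis theorem replaces an arbitrary reservoir
    by a lean one. *)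
Lemma avoids_basis X X0 s : nosub X -> included X0 X -> unbounded X0 -> avoids X0 s ->
  exists X', [/\ included X' X, unbounded X', nosub X' & avoids X' s].
Proof.
move=> noX subX0 infX0 avX0.
pose A (r : env) := (included (real_set (r 0)) (real_set (r 1)) /\ unbounded (real_set (r 0))) /\
  (forall w, supported w (real_set (r 0)) -> ~ seen w s).
have [||X'] := @sig_basis C X A clC noX.
- apply: (proj1 (A := sigma11 _)); apply: del_and.
    by apply: del_and; [exact: del_included | exact: del_unbounded].
  apply: del_allB; apply: del_imp; first exact: (@del_supported _ 1 (tf_var 0)).
  by apply: del_not; apply: del_seen_const; exact: tf_var.
- by exists X0; rewrite /A /= !real_set_chi.
- by rewrite /A /= !real_set_chi => -[[[]]]; exists X'.
Qed.

(** Evidence against [s] is an open family met by every infinite subset of [X]. That all subsets of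
    a set see [s] is not visibly arithmetical, but the homogeneity given by [open_ramsey] is, so the
    basis theorem applies to it. *)
Lemma hits_basis X s : unbounded X -> nosub X ->
  (forall X', included X' X -> unbounded X' -> ~ avoids X' s) ->
  exists X', [/\ included X' X, unbounded X', nosub X' &
    forall Y, included Y X' -> unbounded Y -> exists k, seen (mkseq Y k) s].
Proof.
move=> infX noX noav.
have hit Y : included Y X -> unbounded Y -> exists w, supported w Y /\ seen w s.
  move=> subY infY; apply: contrapT => nw; apply: (noav Y) => // w wY ws.
  by apply: nw; exists w.
have [X0 [subX0 infX0 X0P]] := open_ramsey infX
  (fun w w' pw => @seen_prefix cT cb h w w' s pw) hit.
pose A (r : env) := (included (real_set (r 0)) (real_set (r 1)) /\ unbounded (real_set (r 0))) /\
  (forall u' u, aligned u' -> size u' = size u -> bsub u' u -> supported u (real_set (r 0)) ->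
     seen u' s -> seen u s).
have [||X'] := @sig_basis C X A clC noX.
- apply: (proj1 (A := sigma11 _)); apply: del_and.
    by apply: del_and; [exact: del_included | exact: del_unbounded].
  have t0 := tf_var 0.
  have t1 : tf (fun r => shift r 0 0) := tf_var 1.
  have t2 : tf (fun r => shift (shift r) 0 0) := tf_var 2.
  apply: del_allB; apply: del_allB; apply: del_imp; last apply: del_imp; last apply: del_imp;
    last apply: del_imp; last apply: del_imp.
  + apply: del_allN; apply: del_imp; last by apply: del_bool; exact: tf_nth_bits.
    apply: (@del_ext (fun r => size (decode (shift (shift r) 0 0)) = (r 0 0).+1));
      first by move=> r; rewrite size_map.
    by apply: del_eq; [exact: tf_size | exact: tf_S].
  + apply: (@del_ext (fun r => size (decode (shift r 0 0)) = size (decode (r 0 0))));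
    first by move=> r; rewrite !size_map.
    by apply: del_eq; exact: tf_size.
  + by apply: del_allN; apply: del_imp; apply: del_bool; exact: tf_nth_bits.
  + exact: (@del_supported _ 2).
  + exact: del_seen_const.
  + exact: del_seen_const.
- by exists X0; rewrite /A /= !real_set_chi.
- rewrite /A /= !real_set_chi => -[[[subX' infX'] X'P] noX']; exists X'; split=> // Y subY infY.
  have [w [wY ws]] := hit Y (included_trans subX' subY) infY.
  have [y [ley Yy]] := infY (size w).
  (* Adding an element [y] of [Y] gives the evidence and the initial segment of [Y] the same length
     and the same maximum. *)
  exists y.+1; apply: (X'P (ext w y)).
  + exact: aligned_ext.
  + by rewrite size_ext // size_mkseq.
  + move=> j wj; have Yj := supported_ext ley wY Yy wj.
    rewrite nth_mkseq // -(size_ext ley) ltnNge; apply/negP => lej.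
    by move: wj; rewrite nth_default.
  + exact: supported_included subY (@supported_mkseq _ _).
  + exact: seen_prefix (prefix_ext w y) ws.
Qed.

(** The limits [Z] for which some infinite subset of [X] has tails avoiding every initial segment of
    [Z] form a class Sigma-1-1 in [X]. As [X] is lean, one limit [Z'] is outside [C], and so is a
    whole cylinder around it. A tail avoids this cylinder's string, so a good subset would have a
    path, hence a point of [C], in the cylinder. *)
Lemma bad_of_limit X Z X0 : nosub X -> included X0 X -> unbounded X0 ->
  (forall n, exists k, forall w, supported w X0 -> (forall j, nth false w j -> k <= j) ->
     ~ seen w (mkseq Z n)) ->
  exists X', [/\ included X' X, unbounded X', nosub X' & bad X'].
Proof.
move=> noX subX0 infX0 X0P.
pose A (r : env) := exists R, (included (real_set R) (real_set (r 1)) /\ unbounded (real_set R)) /\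
  forall n, exists k, forall s w, (size s = n /\ forall j, j < size s -> r 0 j = nth 0 s j) ->
    supported w (real_set R) /\ (forall j, nth false w j -> k <= j) -> ~ seen w s.
have sA : sigma11 A.
  apply: sig_exR; apply: (proj1 (A := sigma11 _)); apply: del_and.
    by apply: del_and; [exact: (del_included 0 2) | exact: del_unbounded].
  apply: del_allN; apply: del_exN; apply: del_allS; apply: del_allB.
  have t0 := tf_var 0.
  have t1 : tf (fun r => shift r 0 0) := tf_var 1.
  have t2 : tf (fun r => shift (shift r) 0 0) := tf_var 2.
  have t3 : tf (fun r => shift (shift (shift r)) 0 0) := tf_var 3.
  apply: del_imp; last apply: del_imp.
  - apply: del_and; first by apply: del_eq => //; exact: tf_size.
    apply: del_allN; apply: del_imp; first by apply: del_lt => //; exact: tf_size.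
    by apply: del_eq; [exact: (tf_look 6) | exact: tf_nth].
  - apply: del_and; first exact: (@del_supported _ 4).
    apply: del_allN; apply: del_imp; first by apply: del_bool; exact: tf_nth_bits.
    exact: del_leq.
  - by apply: del_not; apply: del_seen.
have [|Z' [[R [[subR infR] RP]] nCZ']] := noX A sA.
  exists Z; exists (chi X0); rewrite /= !real_set_chi; split=> // n.
  have [k kP] := X0P n; exists k => s w [ss sZ] [wX0 wk].
  rewrite (_ : s = mkseq Z n); first exact: kP.
  apply: (@eq_from_nth _ 0); rewrite ?size_mkseq // => j ltj.
  by rewrite nth_mkseq -?ss // sZ.
rewrite /= real_set_chi in subR RP.
have [n nP] := clC nCZ'; have [k kP] := RP n.
pose X1 x := real_set R x && (k <= x).
have [|||X' [subX' infX' noX' avX']] := @avoids_basis X X1 (mkseq Z' n) noX.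
- by move=> x /andP[/subR].
- move=> m; have [x [lex Rx]] := infR (maxn k m); exists x.
  by move: lex; rewrite geq_max /X1 Rx => /andP[-> ->].
- move=> w wX1; apply: kP.
    by rewrite size_mkseq; split=> // j ltj; rewrite nth_mkseq.
  by split=> j /wX1/andP[].
exists X'; split=> // Y subY infY gY.
have [Z1 [CZ1 /extends_mkseq Z1P]] := avoids_path subY avX' gY.
exact: nP Z1P CZ1.
Qed.

(** If no one-entry extension of [s] can be avoided, thin the reservoir for each of the finitely
    many entries allowed by [bound]. For a good [Y] no path then extends [s], since paths are in [C]
    and so obey [bound]; hence [Y] sees [s], against avoidance. *)
Lemma avoids_step X s : unbounded X -> nosub X -> avoids X s ->
  (exists v X', [/\ included X' X, unbounded X', nosub X' & avoids X' (rcons s v)]) \/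
  (exists X', [/\ included X' X, unbounded X', nosub X' & bad X']).
Proof.
move=> infX noX avX; apply: contrapT => /not_orP[nav nbad].
have [X' [subX' infX' noX' X'P]] : exists X', [/\ included X' X, unbounded X', nosub X' &
    forall v, v < (bound (size s)).+1 -> forall Y, included Y X' -> unbounded Y ->
      exists k, seen (mkseq Y k) (rcons s v)].
  elim: (bound (size s)).+1 => [|m [X1 [subX1 infX1 noX1 X1P]]]; first by exists X; split.
  have [X2 subX2 infX2 avX2|X2 [subX2 infX2 noX2 X2P]] := @hits_basis X1 (rcons s m) infX1 noX1.
    apply: nav; exists m.
    have [X3 [subX3 infX3 noX3 avX3]] := avoids_basis noX1 subX2 infX2 avX2.
    by exists X3; split=> //; exact: included_trans subX3.
  exists X2; split=> //; first exact: included_trans subX2.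
  move=> v; rewrite ltnS leq_eqVlt => /predU1P[->|ltv] Y subY; first exact: X2P.
  by apply: X1P => //; exact: included_trans subY.
apply: nbad; exists X'; split=> // Y subY infY gY.
have [T [gT _ TC]] := gY.
have [|k kP] := seen_complete gT (s := s).
  move=> Z ZT Zs.
  have [|k sk] := X'P (Z (size s)) _ Y subY infY; first by rewrite ltnS; apply: boundC; exact: TC.
  apply: (seen_sound gT sk ZT) => j; rewrite size_rcons ltnS leq_eqVlt => /predU1P[->|ltj].
    by rewrite nth_rcons ltnn eqxx.
  by rewrite nth_rcons ltj; exact: Zs.
apply: (avX (mkseq Y k)); last exact: kP.
exact: supported_included (included_trans subX' subY) (@supported_mkseq _ _).
Qed.

Lemma exists_bad X : unbounded X -> nosub X ->
  exists X', [/\ included X' X, unbounded X', nosub X' & bad X'].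
Proof.
move=> infX noX; apply: contrapT => nbad.
have [X0 [subX0 infX0 noX0 avX0]] : exists X', [/\ included X' X, unbounded X', nosub X' &
  avoids X' [::]].
  apply: contrapT => nav; apply: nbad.
  (* If the empty string cannot be avoided, some lean reservoir has only infinite subsets whose tree
     has no path. *)
  have [X1 subX1 infX1 avX1|X1 [subX1 infX1 noX1 X1P]] := @hits_basis X [::] infX noX.
    by apply: nav; exact: avoids_basis infX1 avX1.
  exists X1; split=> // Y subY infY [T [gT [Z ZT] _]].
  by have [k sk] := X1P Y subY infY; exact: (seen_sound gT sk ZT).
pose ok (p : seq nat * (nat -> bool)) := [/\ included p.2 X, unbounded p.2, nosub p.2 &
  avoids p.2 p.1].
have /choice[nxt nxtP] p : exists q, ok p -> [/\ ok q, included q.2 p.2 &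
  exists v, q.1 = rcons p.1 v].
  case: (pselect (ok p)) => [[sub2 inf2 no2 av2]|]; last by exists p.
  have [[v [X' [subX' infX' noX' avX']]]|[X' [subX' infX' noX' badX']]] := avoids_step inf2 no2 av2.
    exists (rcons p.1 v, X') => _; split=> //; last by exists v.
    by split=> //; exact: included_trans subX'.
  by case: nbad; exists X'; split=> //; exact: included_trans subX'.
pose fix ps n := if n is m.+1 then nxt (ps m) else ([::], X0).
have okp n : ok (ps n) by elim: n => [|n /nxtP[]].
have pS n : included (ps n.+1).2 (ps n).2 /\ exists v, (ps n.+1).1 = rcons (ps n).1 v.
  by have [] := nxtP _ (okp n).
have /choice[Z ZP] n : exists v, (ps n.+1).1 = rcons (ps n).1 v by have [] := pS n.
have mkZ n : mkseq Z n = (ps n).1 by elim: n => // n IHn; rewrite mkseqS_rcons IHn ZP.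
have [X1 [subX1 infX1 X1P]] := @fusion_sequence (fun n => (ps n).2)
  (fun n => let: And4 _ inf _ _ := okp n in inf) (fun n => (pS n).1).
apply: nbad; apply: (@bad_of_limit X Z X1) => //; first exact: included_trans subX1.
move=> n; have [k kP] := X1P n; exists k => w wX1 wk.
have [_ _ _ av] := okp n; rewrite mkZ; apply: av => j wj.
by apply: kP; [exact: wX1 | exact: wk].
Qed.

End Step.


(** * Combinatorial consequences of compactness *)

Lemma open_coordinate (j : nat) (Q : set nat) : open [set Z : baire | Q (Z j)].
Proof.
apply: (@open_comp baire nat (fun Z => Z j)); last exact: discrete_open.
move=> Z _; exact: (@proj_continuous nat (fun=> nat) j).
Qed.

(** Finite subcovers of an increasing open cover, in filter form: if no [P n] covers [C], the
    differences of [C] and [P n] generate a proper filter. Its cluster point in [C] lies in some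
    open [P n], which would meet its own complement. *)
Lemma compact_uniform (C : set baire) (P : nat -> set baire) : compact C ->
  (forall n, open (P n)) -> (forall m n Z, m <= n -> P m Z -> P n Z) ->
  (forall Z, C Z -> exists n, P n Z) -> exists n, forall Z, C Z -> P n Z.
Proof.
move=> cC openP monoP CP; apply: contrapT => /forallNP nP.
pose F := [set A : set baire | exists n, forall Z, C Z -> ~ P n Z -> A Z].
have FF : ProperFilter F.
  split; first by move=> [n nF]; apply: (nP n) => Z CZ; apply: contrapT => /(nF _ CZ).
  split; first by exists 0.
    move=> A B [m mA] [n nB]; exists (maxn m n) => Z CZ nPZ; split.
      by apply: mA => // /(monoP _ _ _ (leq_maxl m n)).
    by apply: nB => // /(monoP _ _ _ (leq_maxr m n)).
  by move=> A B AB [n nA]; exists n => Z CZ /(nA _ CZ)/AB.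
have [|Z [CZ clZ]] := cC F FF; first by exists 0.
have [n Pn] := CP Z CZ.
have [|Z' [[CZ' nPZ'] PZ']] := clZ [set Z | C Z /\ ~ P n Z] (P n) _ (open_nbhs_nbhs (conj (openP n) Pn)).
  by exists n.
exact: nPZ'.
Qed.

(** The points that differ from [Z] before place [n] form an increasing open cover of [C]. *)
Lemma compact_seq_closed (C : set baire) : compact C -> seq_closed C.
Proof.
move=> cC Z nCZ.
have [|||n nP] := @compact_uniform C (fun n => [set Z' | exists j, j < n /\ Z' j <> Z j]) cC.
- move=> n; rewrite (_ : [set _ | _] = \bigcup_(j in [set j | j < n]) [set Z' | Z' j <> Z j]).
    by apply: bigcup_open => j _; exact: (open_coordinate j (fun x => x <> Z j)).
  by apply/seteqP; split=> Z' [j]; [move=> [ltj nj]; exists j | move=> ltj nj; exists j].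
- by move=> m n Z' lemn [j [ltj nj]]; exists j; split=> //; exact: leq_trans ltj lemn.
- move=> Z' CZ'; apply: contrapT => eqZ; apply: nCZ; rewrite (_ : Z = Z') //.
  apply/funext => j; apply: contrapT => nj; apply: eqZ; exists j.+1, j; split=> // eqj.
  by apply: nj.
- by exists n => Z' eqZ /nP[j [/eqZ]].
Qed.

Lemma compact_bounded_by (C : set baire) : compact C ->
  exists bound : nat -> nat, forall Z n, C Z -> Z n <= bound n.
Proof.
move=> cC; have /choice[bound boundP] n : exists m, forall Z : baire, C Z -> Z n <= m.
  apply: (@compact_uniform C (fun m => [set Z | Z n <= m]) cC).
  - by move=> m; exact: (open_coordinate n (fun x => x <= m)).
  - by move=> m m' Z lem /= leZ; exact: leq_trans leZ lem.
  - by move=> Z _; exists (Z n) => /=.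
by exists bound => Z n /boundP.
Qed.

(** * Diagonalisation over all codes *)

Lemma all_strings (P : (nat -> bool) -> Prop) (R : seq bool -> (nat -> bool) -> Prop) :
  (forall w X X', included X' X -> R w X -> R w X') ->
  (forall w X, P X -> exists X', [/\ included X' X, P X' & R w X']) ->
  forall m X, P X -> exists X', [/\ included X' X, P X' & forall w, size w = m -> R w X'].
Proof.
move=> her dense m; elim: m R her dense => [|m IHm] R her dense X PX.
  have [X' [subX' PX' RX']] := dense [::] X PX.
  by exists X'; split=> // w /size0nil->.
have [X1 [sub1 P1 R1]] := IHm (fun w => R (true :: w))
  (fun w => her (true :: w)) (fun w => dense (true :: w)) X PX.
have [X2 [sub2 P2 R2]] := IHm (fun w => R (false :: w))
  (fun w => her (false :: w)) (fun w => dense (false :: w)) X1 P1.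
exists X2; split=> //; first exact: included_trans sub2.
by move=> [|[] w] // [ew]; [apply: her sub2 _; exact: R1 | exact: R2].
Qed.

Lemma unbounded_infinite (A : set nat) :
  (forall n, exists m, n <= m /\ A m) -> infinite_set A.
Proof.
move=> infA /finite_seqP[s eA]; have [m [lem]] := infA (\max_(i <- s) i).+1.
rewrite eA /= => ms; move: lem; rewrite ltnNge; apply/negP; rewrite negbK.
exact: (@leq_bigmax_seq _ _ xpredT id).
Qed.

Lemma infinite_unbounded (A : set nat) :
  infinite_set A -> forall n, exists m, n <= m /\ A m.
Proof.
move=> infA n; apply: contrapT => nA; apply: infA; apply: sub_finite_set (finite_II n) => m Am /=.
by rewrite ltnNge; apply/negP => lenm; apply: nA; exists m.
Qed.

(** Stage [n] chooses an element [y] of the reservoir and then thins the reservoir until it is bad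
    for the [n]-th pair of codes and every head of length [y.+1]. A subset of the set of chosen
    elements is a head followed by a subset of the reservoir, so no pair of codes works for it. *)
Lemma not_encodable (C : set baire) : compact C -> no_sig_subset C (fun=> true) ->
  ~ Pi01_encodable C.
Proof.
move=> cC no1 encC.
have clC := compact_seq_closed cC; have [bound boundC] := compact_bounded_by cC.
have [enum enumP] := enum_recfun2.
pose ok (X : nat -> bool) := unbounded X /\ no_sig_subset C X.
have step c m X : ok X -> exists X', [/\ included X' X, ok X' &
    forall h, size h = m -> bad C c.1 c.2 h X'].
  apply: all_strings => [h Y Y'|h Y [infY noY]]; first exact: bad_included.
  have [Y' [subY' infY' noY' badY']] := exists_bad c.1 c.2 h clC boundC infY noY.
  by exists Y'.
(* A state is a pair [(X, x)]: the current reservoir and the last element chosen. *)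
have /choice[nxt nxtP] p : exists q : (nat -> bool) * nat, ok p.2.1 ->
    [/\ included q.1 p.2.1, ok q.1, p.2.2 < q.2, p.2.1 q.2 &
     forall h, size h = q.2.+1 -> bad C (enum p.1).1 (enum p.1).2 h q.1].
  case: p => n [X x] /=; case: (pselect (ok X)) => [okX|]; last by exists (X, x).
  have [y [lty Xy]] := okX.1 x.+1.
  have [X' [subX' okX' badX']] := step (enum n) y.+1 X okX.
  by exists (X', y).
pose fix st n := if n is m.+1 then nxt (m, st m) else ((fun=> true), 0).
have okst n : ok (st n).1.
  elim: n => [|n IHn]; last by have [] := nxtP (n, st n) IHn.
  by split=> // n; exists n.
have stP n := nxtP (n, st n) (okst n).
have sub m n : m <= n -> included (st n).1 (st m).1.
  move=> /subnKC <-; elim: (n - m) => [|k IHk] x; rewrite ?addn0 // addnS.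
  by have [H _ _ _ _] := stP (m + k) => /H; exact: IHk.
have lty n : (st n).2 < (st n.+1).2 by have [] := stP n.
have ley m n : m <= n -> (st m).2 <= (st n).2.
  by move=> /subnKC <-; elim: (n - m) => [|k IHk]; rewrite ?addn0 // addnS;
    exact: leq_trans IHk (ltnW (lty _)).
have gey n : n <= (st n).2 by elim: n => // n IHn; exact: leq_ltn_trans IHn (lty n).
pose X := [set x | exists n, x = (st n.+1).2].
have [|Y [infY subY [_ [[T [b [treeT [fT [cT eT] fTP] [cb eb] bT ->]]] [Z0 TZ0] TC]]]] := encC X.
  by apply: unbounded_infinite => n; exists (st n.+1).2; split;
    [exact: leq_trans (leqnSn n) (gey n.+1) | exists n].
have [n en] := enumP (cT, cb).
(* [Y] is split after the element chosen at the stage of its own codes: [h] is the head and [Y']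
   lies in the reservoir of that stage. *)
pose y := (st n.+1).2; pose Yb x := `[< Y x >].
pose h := mkseq Yb y.+1; pose Y' x := Yb x && (y < x).
have [_ _ _ _ badn] := stP n; rewrite en in badn.
apply: (badn h _ Y'); first by rewrite size_mkseq.
- move=> x /andP[/asboolP /subY[m ->]] lt_y.
  have ltnm : n < m.
    by rewrite ltnNge; apply/negP => lemn; move: lt_y; rewrite ltnNge ley.
  by have [_ _ _ Hm _] := stP m; exact: sub ltnm _ Hm.
- move=> m; have [k [lek Yk]] := infinite_unbounded infY (maxn m y.+1).
  exists k; move: lek; rewrite geq_max => /andP[lemk ltyk]; split=> //.
  by apply/andP; split=> //; exact/asboolP.
rewrite (_ : oracle h Y' = char_fun Y); last first.
  apply/funext => x; rewrite /oracle /char_fun /Y' /h; congr nat_of_bool.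
  case: (leqP x y) => lexy; first by rewrite nth_mkseq // andbF orbF.
  by rewrite nth_default ?size_mkseq // andbT.
exists T; split; [|by exists Z0 | exact: TC].
by exists b; split=> // s; rewrite -fTP.
Qed.

Lemma encodable_Sigma11 (C : set baire) : compact C -> Pi01_encodable C ->
  exists S : set baire, [/\ Sigma11 S, S !=set0 & S `<=` C].
Proof.
move=> cC encC; apply: contrapT => noS; apply: (not_encodable cC) encC => A sA [Z AZ].
apply: contrapT => nZ; apply: noS.
exists [set Z | A (Z .: chi (fun=> true) .: zenv)]; split.
(* The set of all numbers is the constant real 1, which is substituted away to give a lightface
   class. *)
- apply: (@sig_Sigma11 (fun r => A (r 0 .: cst 1 .: shift r))).
  apply: sig_sub => // -[|[|i]] /=.
  + exact: (tf_look 1 (tf_var 0)).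
  + exact: tf_const.
  + exact: (tf_look i.+2 (tf_var 0)).
- by exists Z.
- by move=> Z' AZ'; apply: contrapT => nCZ'; apply: nZ; exists Z'.
Qed.


(** * Moduli *)

Lemma cb_Pi01_in_trans (Z Z' : nat -> nat) D :
  computable_in Z Z' -> cb_Pi01_in Z' D -> cb_Pi01_in Z D.
Proof.
move=> cZ [T [b [treeT [f cf fT] cb bT eD]]]; exists T, b; split=> //.
  by exists f => //; exact: computable_trans cf.
exact: computable_trans cb.
Qed.

(** Take [Y] in [X] so sparse that its increasing enumeration dominates the modulus; [Y] computes
    this enumeration. *)
Lemma modulus_encodable (C : set baire) : admits_Pi01_modulus C -> Pi01_encodable C.
Proof.
move=> [f fP] X infX.
have /choice[ch chP] m : exists x, m <= x /\ X x by exact: infinite_unbounded infX m.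
pose fix y n := if n is m.+1 then ch (maxn (f n) (y m).+1) else ch (f 0).
have lty n : y n < y n.+1 by apply: leq_trans (chP _).1; exact: leq_maxr.
have yX n : X (y n) by case: n => [|n]; exact: (chP _).2.
have fy n : f n <= y n.
  by case: n => [|n]; first exact: (chP _).1; apply: leq_trans (chP _).1; exact: leq_maxl.
have ley m n : m <= n -> y m <= y n.
  by move=> /subnKC <-; elim: (n - m) => [|k IHk]; rewrite ?addn0 // addnS;
    exact: leq_trans IHk (ltnW (lty _)).
have gey n : n <= y n by elim: n => // n IHn; exact: leq_ltn_trans IHn (lty n).
pose Y := [set x | exists n, x = y n].
exists Y; split.
- by apply: unbounded_infinite => n; exists (y n); split=> //; exists n.
- by move=> x [n ->].
have cY : computable_in (char_fun Y) y.
  have exY v : exists x, (v < x) && `[< Y x >].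
    by exists (y v.+1); rewrite (leq_trans _ (gey _)) //=; apply/asboolP; exists v.+1.
  (* The enumeration iterates the search for the next element of [Y], starting from the constant
     [y 0]. *)
  pose nxt v := ex_minn (exY v).
  rewrite (_ : y = fun n => nat_rect (fun=> nat) (y 0) (fun _ v => nxt v) n).
    apply: computable_rec; [exact: computable_const | | exact: computable_id].
    apply: (@computable_comp _ nxt); last by do 2!apply: computable_psnd; exact: computable_id.
    apply: (@computable_mu _ (fun v x => (v < x) && `[< Y x >])).
      apply: computable_and.
        by apply: computable_leq; [apply: computable_S;
          exact: computable_pfst_id | exact: computable_psnd_id].
      by apply: (@computable_comp _ (char_fun Y) psnd);
        [exact: computable_oracle | exact: computable_psnd_id].
    move=> v; rewrite /nxt; case: ex_minnP => x Yx minx; split=> // j ltj.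
    by apply/negP => /minx; rewrite leqNgt ltj.
  apply/funext; elim=> // n IHn; rewrite [RHS]/= -IHn /nxt.
  case: ex_minnP => x /andP[ltx /asboolP[m em]] minx; apply/eqP; rewrite eqn_leq.
  rewrite [X in _ && X]minx ?andbT; last by rewrite lty /=; apply/asboolP; exists n.+1.
  rewrite em; apply: (ley n.+1 m); rewrite ltnNge; apply/negP => lemn.
  by move: ltx; rewrite em ltnNge ley.
have [D [cD neD DC]] := fP y fy; exists D; split=> //.
exact: cb_Pi01_in_trans cY cD.
Qed.

Lemma eq_mkseq_oplus (X X' Y Y' : nat -> nat) n :
  (forall j, j < n -> X j = X' j) -> (forall j, j < n -> Y j = Y' j) ->
  mkseq (oplus X Y) n.*2 = mkseq (oplus X' Y') n.*2.
Proof.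
move=> eX eY; apply/eq_in_map => i; rewrite mem_iota /= add0n => lti.
by rewrite /oplus; case: ifP => _; [apply: eY | apply: eX]; lia.
Qed.

(** The modulus dominates a point of [S] and its witness. For [g] above it, the tree of [g]-bounded
    strings that have a [g]-bounded partial witness of the same length is computable in [g] and
    contains that point. Koenig's lemma, applied to the partial witnesses, puts every path in
    [S]. *)
Lemma Sigma11_modulus (C S : set baire) : Sigma11 S -> S !=set0 -> S `<=` C ->
  admits_Pi01_modulus C.
Proof.
move=> [T [treeT [f cf fT] ->]] [X0 [Y0 XY0]] SC.
exists (fun n => maxn (X0 n) (Y0 n)) => g geg.
pose bnd (s : seq nat) := forall j, j < size s -> nth 0 s j <= g j.
pose T' := [set s : seq nat | bnd s /\ exists t : seq nat, [/\ size t = size s, bnd t &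
  T (mkseq (oplus (nth 0 s) (nth 0 t)) (size s).*2)]].
have cg := computable_oracle g.
have cfg : computable_in g f by apply: computable_trans cf; exact: computable_const.
have c1 := computable_pfst_id g; have c2 := computable_psnd_id g; have ci := computable_id g.
pose allb k := all (fun j => nth 0 (decode k) j <= g j) (iota 0 (size (decode k))).
have allbP s : reflect (bnd s) (allb (string_code s)).
  rewrite /allb string_codeK; apply: (iffP allP) => H j; last by rewrite mem_iota => /H.
  by move=> ltj; apply: H; rewrite mem_iota.
have callb F : computable_in g F -> computable_in g (fun n => allb (F n)).
  apply: (@computable_comp _ (fun n => allb n)).
  apply: (@computable_all _ (fun k j => nth 0 (decode k) j <= g j)); last exact: computable_size.
  by apply: computable_leq; [exact: computable_nth | exact: computable_comp].
pose join k c := string_code (mkseq (oplus (nth 0 (decode k)) (nth 0 (decode c))) (size (decode k)).*2).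
have cjoin : computable_in g (fun p => join (pfst p) (psnd p)).
  apply: (@computable_mkseq _ (fun p => oplus (nth 0 (decode (pfst p))) (nth 0 (decode (psnd p))))).
    apply: (@computable_if _ (fun q => odd (psnd q))); first exact: computable_odd.
      by apply: computable_nth; [exact: computable_psnd | exact: computable_half].
    by apply: computable_nth; [exact: computable_pfst | exact: computable_half].
  by apply: computable_double; exact: computable_size.
pose test k c := (size (decode c) == size (decode k)) && allb c && (f (join k c) == 1).
have ctest : computable_in g (fun p => test (pfst p) (psnd p)).
  apply: computable_and; first apply: computable_and.
  - by apply: computable_eq; exact: computable_size.
  - exact: callb.
  - by apply: computable_eq; [exact: computable_comp | exact: computable_const].
(* Codes are monotone in the entries, so every [g]-bounded string of this length has a code at most
   that of the restriction of [g]. *)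
pose M k := (string_code (mkseq g (size (decode k)))).+1.
have testP s : (exists t : seq nat, [/\ size t = size s, bnd t &
    T (mkseq (oplus (nth 0 s) (nth 0 t)) (size s).*2)]) <->
    has (test (string_code s)) (iota 0 (M (string_code s))).
  rewrite /test /join /M !string_codeK; split.
    move=> [t [et bt Tt]]; apply/hasP; exists (string_code t).
      rewrite mem_iota ltnS /=; apply: leq_string_code; first by rewrite size_mkseq.
      by move=> j ltj; rewrite nth_mkseq -?et //; exact: bt.
    by rewrite string_codeK et eqxx fT asboolT // andbT; exact/allbP.
  move=> /hasP[c _ /andP[/andP[/eqP ec bc] fc]]; exists (decode c); split=> //.
    by apply/allbP; rewrite decodeK.
  by move: fc; rewrite fT; case: asboolP.
exists (paths T'); split.
- exists T', g; split=> //.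
  + move=> s t /prefixP[u ->] [bt [v [ev bv Tv]]].
    have les : size s <= size v by rewrite ev size_cat leq_addr.
    split.
      move=> j ltj; have := bt j; rewrite size_cat nth_cat ltj; apply; exact: ltn_addr.
    exists (take (size s) v); split; first by rewrite size_takel.
      by move=> j; rewrite size_takel // => ltj; rewrite nth_take //; apply: bv;
        exact: leq_trans ltj les.
    apply: treeT Tv; rewrite (@eq_mkseq_oplus _ (nth 0 (s ++ u)) _ (nth 0 v)).
    * by apply: prefix_mkseq; rewrite leq_double size_cat leq_addr.
    * by move=> j ltj; rewrite nth_cat ltj.
    * by move=> j ltj; rewrite nth_take.
  + exists (fun k => allb k && has (test k) (iota 0 (M k))).
      apply: computable_and; first exact: callb.
      apply: computable_has => //; apply: computable_S.
      by apply: (@computable_mkseq _ (fun=> g)); [exact: computable_comp | exact: computable_size].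
    move=> s; congr nat_of_bool; apply/idP/asboolP.
      by move=> /andP[/allbP bs /testP].
    by move=> [/allbP bs /testP Ts]; apply/andP.
  + by move=> s x [bs _]; exact: bs.
- exists X0 => n; split.
    by move=> j; rewrite size_mkseq => ltj; rewrite nth_mkseq //; apply: leq_trans (geg j);
      exact: leq_maxl.
  exists (mkseq Y0 n); split; first by rewrite !size_mkseq.
    by move=> j; rewrite size_mkseq => ltj; rewrite nth_mkseq //; apply: leq_trans (geg j);
      exact: leq_maxr.
  rewrite size_mkseq (@eq_mkseq_oplus _ X0 _ Y0) // => j ltj; by rewrite nth_mkseq.
- move=> Z ZT'; apply: SC.
  (* The partial witnesses for the fixed path [Z] form a [g]-bounded tree, with members of every
     length. *)
  pose T2 := [set t : seq nat | bnd t /\ T (mkseq (oplus Z (nth 0 t)) (size t).*2)].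
  have [|||Y YT2] := @konig T2 g.
  + move=> s t /prefixP[u ->] [bt Tt]; split.
      move=> j ltj; have := bt j; rewrite size_cat nth_cat ltj; apply; exact: ltn_addr.
    apply: treeT Tt; rewrite (@eq_mkseq_oplus _ Z _ (nth 0 (s ++ u))) //.
      by apply: prefix_mkseq; rewrite leq_double size_cat leq_addr.
    by move=> j ltj; rewrite nth_cat ltj.
  + by move=> s x [bs _]; exact: bs.
  + move=> l; have [_ [t [et bt Tt]]] := ZT' l; move: et Tt; rewrite size_mkseq => et Tt.
    exists t; split; last by rewrite et.
    split=> //; rewrite et (@eq_mkseq_oplus _ (nth 0 (mkseq Z l)) _ (nth 0 t)) // => j ltj.
    by rewrite nth_mkseq.
  exists Y => n; have [_] := YT2 n; rewrite size_mkseq (@eq_mkseq_oplus _ Z _ Y) //.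
    by apply: treeT; apply: prefix_mkseq; lia.
  by move=> j ltj; rewrite nth_mkseq.
Qed.

Theorem theorem2p1 (C : set {ptws nat -> nat}) (hC : compact C) :
  (Pi01_encodable C <-> admits_Pi01_modulus C) /\
  (admits_Pi01_modulus C <->
     exists S : set {ptws nat -> nat}, [/\ Sigma11 S, S !=set0 & S `<=` C]).
Proof.
have iii_ii : (exists S : set baire, [/\ Sigma11 S, S !=set0 & S `<=` C]) -> admits_Pi01_modulus C.
  by move=> [S [sS neS SC]]; exact: Sigma11_modulus sS neS SC.
split; split.
- by move=> /(encodable_Sigma11 hC)/iii_ii.
- exact: modulus_encodable.
- by move=> /modulus_encodable/(encodable_Sigma11 hC).
- exact: iii_ii.
Qed.
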